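(* Let $(X,d)$ be a uniformly locally finite metric space. The following are equivalent: (1) There are no non-compact block-rank-one ghost projections in $\mathrm{C}^*_u(X)$. (2) $X$ has the operator norm localization property (ONL) for equi-approximable rank-one projections.
   Context: A metric space $(X,d)$ is uniformly locally finite if for each $r>0$ there is $N$ such that every ball of radius $r$ has at most $N$ elements. $\ell_2(X)$ has canonical orthonormal basis $(\delta_x)_{x\in X}$; for $A\subseteq X$, $\chi_A$ is the orthogonal projection onto $\ell_2(A)\subseteq\ell_2(X)$. For $a\in\mathcal B(\ell_2(X))$ put $a_{x,z}=\langle a\delta_z,\delta_x\rangle$ and $\mathrm{prop}(a)=\sup\{d(x,y)\mid\langle a\delta_x,\delta_y\rangle\ne0\}$. The uniform Roe algebra $\mathrm{C}^*_u(X)$ is the norm closure in $\mathcal B(\ell_2(X))$ of the operators with finite propagation. ''Projection'' means self-adjoint idempotent operator. Ghost: $a\in\mathrm{C}^*_u(X)$ is a ghost if for all $\varepsilon>0$ there is a finite $A\subseteq X$ with $|a_{x,z}|\le\varepsilon$ for all $x,z\notin A$. Block-rank-one projection: a projection $p\in\mathrm{C}^*_u(X)$ for which there is a disjoint sequence $(X_n)_{n\in\mathbb N}$ of finite non-empty subsets of $X$ with $p=\sum_n\chi_{X_n}p\chi_{X_n}$ (convergence in the strong operator topology) and each $\chi_{X_n}p\chi_{X_n}$ of rank 1. Equi-approximable: $S\subseteq\mathrm{C}^*_u(X)$ is equi-approximable if for all $\varepsilon>0$ there is $s>0$ such that for all $a\in S$ there is $b\in\mathcal B(\ell_2(X))$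 with $\mathrm{prop}(b)\le s$ and $\|a-b\|\le\varepsilon$. ONL for equi-approximable rank-one projections: for all $\varepsilon>0$ and all equi-approximable families $S\subseteq\mathrm{C}^*_u(X)$ consisting of rank-one projections, there is $s>0$ such that for all $a\in S$ some unit vector $\xi\in\ell_2(X)$ satisfies $\mathrm{diam}(\mathrm{supp}(\xi))\le s$ and $\|a\xi\|\ge(1-\varepsilon)\|a\|$. *)

(* Defs.v *)
From HB Require Import structures.
From mathcomp Require Import all_boot all_order all_algebra.
From mathcomp Require Import all_classical all_reals all_analysis.
From mathcomp Require Import ring.
From mathcomp.real_closed Require Import complex.
Import Order.TTheory GRing.Theory Num.Theory.
Import numFieldNormedType.Exports.
Import ComplexField.Normc.

Set Implicit Arguments.
Unset Strict Implicit.
Unset Printing Implicit Defensive.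

Local Open Scope classical_set_scope.
Local Open Scope ring_scope.
Local Open Scope complex_scope.

Section square_summable.
Context {R : realType} {X : choiceType}.
Implicit Types f g : X -> R[i].

(* [normc z : R] is the modulus of z; [`|z|] has the same value, but in R[i]. *)
Definition sumsq f : \bar R := \esum_(x in setT) (normc (f x) ^+ 2)%:E.

Definition square_summable : {pred X -> R[i]} := fun f => (sumsq f < +oo)%E.

Lemma normc_ge0 (z : R[i]) : 0 <= normc z.
Proof. by case: z => a b; exact: sqrtr_ge0. Qed.

Lemma sumsq_ge0 f : (0 <= sumsq f)%E.
Proof. by apply: esum_ge0 => x _; rewrite lee_fin sqr_ge0. Qed.

Lemma square_summable_fin f : f \in square_summable -> sumsq f \is a fin_num.
Proof. by move=> fs; rewrite ge0_fin_numE// sumsq_ge0. Qed.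

Lemma esumZl_le (c : R) (a : X -> \bar R) : 0 <= c -> (forall x, 0 <= a x)%E ->
  (\esum_(x in setT) (c%:E * a x) <= c%:E * \esum_(x in setT) a x)%E.
Proof.
move=> c0 a0; apply: ge_ereal_sup => _ [F [finF _]] <-.
rewrite -ge0_mule_fsumr; last by move=> x; exact: a0.
by rewrite lee_wpmul2l ?lee_fin//; apply: ereal_sup_ubound; exists F.
Qed.

Lemma sumsqZ_le (c : R[i]) f :
  (sumsq (c *: f) <= (normc c ^+ 2)%:E * sumsq f)%E.
Proof.
apply: le_trans (esumZl_le _ _); last first.
- by move=> x; rewrite lee_fin sqr_ge0.
- exact: sqr_ge0.
by apply: le_esum => x _; rewrite -EFinM -exprMn -normcM.
Qed.

Lemma sqrD_le (c u v : R) : 0 < c ->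
  (u + v) ^+ 2 <= (1 + c) * u ^+ 2 + (1 + c^-1) * v ^+ 2.
Proof.
move=> c0; rewrite -subr_ge0.
suff -> : (1 + c) * u ^+ 2 + (1 + c^-1) * v ^+ 2 - (u + v) ^+ 2 =
          c^-1 * (c * u - v) ^+ 2.
  by rewrite mulr_ge0 ?sqr_ge0// invr_ge0 ltW.
by field; rewrite gt_eqF.
Qed.

Lemma sumsqD_le (c : R) f g : 0 < c ->
  (sumsq (f + g)%R <= (1 + c)%:E * sumsq f + (1 + c^-1)%:E * sumsq g)%E.
Proof.
move=> c0; have ci0 : 0 < c^-1 by rewrite invr_gt0.
have sq0 (h : X -> R[i]) x : (0 <= (normc (h x) ^+ 2)%:E)%E by rewrite lee_fin sqr_ge0.
apply: le_trans (leeD (esumZl_le _ (sq0 f)) (esumZl_le _ (sq0 g))).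
- rewrite -esumD; first last.
  + by move=> x _; rewrite mule_ge0// lee_fin addr_ge0// ltW.
  + by move=> x _; rewrite mule_ge0// lee_fin addr_ge0// ltW.
  apply: le_esum => x _; rewrite -!EFinM -EFinD lee_fin.
  apply: le_trans (sqrD_le _ _ c0).
  by rewrite ler_pXn2r ?nnegrE ?addr_ge0 ?normc_ge0//; exact: le_normcD.
- by rewrite addr_ge0// ltW.
- by rewrite addr_ge0// ltW.
Qed.

Lemma square_summable_submod : submod_closed square_summable.
Proof.
split=> [|c f g fs gs].
  rewrite /in_mem/= /square_summable /sumsq esum1 ?ltry// => x _.
  by rewrite normc0 expr0n.
have fin (d : R) h : h \in square_summable ->
    (d%:E * sumsq h < +oo)%E.
  by move=> /square_summable_fin/fineK <-; rewrite -EFinM ltry.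
have cfs : c *: f \in square_summable by exact: le_lt_trans (sumsqZ_le _ _) (fin _ _ fs).
apply: le_lt_trans (sumsqD_le _ _ (@ltr01 R)) _.
by rewrite lte_add_pinfty// fin.
Qed.

HB.instance Definition _ := GRing.isSubmodClosed.Build R[i] (X -> R[i])
  square_summable square_summable_submod.

End square_summable.

Record ell2 (R : realType) (X : choiceType) := Ell2 {
  ell2_val :> X -> R[i];
  ell2_valP : ell2_val \in square_summable }.

HB.instance Definition _ (R : realType) (X : choiceType) :=
  [isSub for @ell2_val R X].
HB.instance Definition _ (R : realType) (X : choiceType) :=
  [Choice of ell2 R X by <:].
HB.instance Definition _ (R : realType) (X : choiceType) :=
  [SubChoice_isSubLmodule of ell2 R X by <:].

Section ell2_norm.
Context {R : realType} {X : choiceType}.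
Implicit Types xi eta : ell2 R X.

Definition l2norm xi : R := Num.sqrt (fine (sumsq xi)).

Lemma l2norm_ge0 xi : 0 <= l2norm xi. Proof. exact: sqrtr_ge0. Qed.

Lemma sumsqE xi : sumsq xi = (l2norm xi ^+ 2)%:E.
Proof.
have xif := square_summable_fin (ell2_valP xi).
by rewrite sqr_sqrtr ?fine_ge0 ?sumsq_ge0// fineK.
Qed.

Lemma l2norm_le xi (r : R) :
  0 <= r -> (sumsq xi <= (r ^+ 2)%:E)%E -> l2norm xi <= r.
Proof.
by move=> r0; rewrite sumsqE lee_fin ler_pXn2r ?nnegrE// l2norm_ge0.
Qed.

Lemma l2norm0 : l2norm 0 = 0.
Proof.
apply/eqP; rewrite eq_le l2norm_ge0 andbT; apply: l2norm_le => //.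
rewrite /sumsq esum1 ?expr0n// => x _.
by have -> : (0 : ell2 R X) x = 0 by []; rewrite normc0 expr0n.
Qed.

Lemma normc_le_l2norm xi x : normc (xi x) <= l2norm xi.
Proof.
rewrite -(@ler_pXn2r _ 2) ?nnegrE ?normc_ge0 ?l2norm_ge0// -lee_fin -sumsqE.
rewrite /sumsq (esumID [set x]); last by move=> y _; rewrite lee_fin sqr_ge0.
rewrite setTI esum_set1 ?lee_fin ?sqr_ge0// leeDl//.
by apply: esum_ge0 => y _; rewrite lee_fin sqr_ge0.
Qed.

Lemma l2norm_eq0 xi : l2norm xi = 0 -> xi = 0.
Proof.
move=> xi0; apply/val_inj/funext => x /=; apply: eq0_normc; apply/eqP.
by rewrite eq_le normc_ge0 andbT -xi0 normc_le_l2norm.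
Qed.

Lemma l2normZ (c : R[i]) xi : l2norm (c *: xi) = normc c * l2norm xi.
Proof.
have le d eta : l2norm (d *: eta) <= normc d * l2norm eta.
  apply: l2norm_le; first by rewrite mulr_ge0 ?normc_ge0 ?l2norm_ge0.
  by rewrite exprMn EFinM -sumsqE; exact: sumsqZ_le.
apply/eqP; rewrite eq_le le/=.
have [->|c0] := eqVneq c 0; first by rewrite normc0 mul0r l2norm_ge0.
have nc0 : 0 < normc c.
  by rewrite lt_neqAle normc_ge0 andbT eq_sym; apply: contra c0 => /eqP/eq0_normc ->.
rewrite mulrC -ler_pdivlMr// mulrC -normcV.
by have := le c^-1 (c *: xi); rewrite scalerA mulVf// scale1r.
Qed.

Lemma l2normD xi eta : l2norm (xi + eta) <= l2norm xi + l2norm eta.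
Proof.
have [/l2norm_eq0->|xi0] := eqVneq (l2norm xi) 0.
  by rewrite add0r l2norm0 add0r.
have [/l2norm_eq0->|eta0] := eqVneq (l2norm eta) 0.
  by rewrite addr0 l2norm0 addr0.
have xip : 0 < l2norm xi by rewrite lt_neqAle eq_sym xi0 l2norm_ge0.
have etap : 0 < l2norm eta by rewrite lt_neqAle eq_sym eta0 l2norm_ge0.
apply: l2norm_le; first by rewrite addr_ge0 ?l2norm_ge0.
apply: le_trans (sumsqD_le _ _ (divr_gt0 etap xip)) _.
rewrite !sumsqE -!EFinM -EFinD lee_fin.
by rewrite le_eqVlt; apply/orP; left; apply/eqP; field; rewrite xi0.
Qed.

Let normC xi : R[i] := (l2norm xi)%:C.

Let normCD xi eta : normC (xi + eta) <= normC xi + normC eta.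
Proof. by rewrite /normC -rmorphD lecR l2normD. Qed.

Let normCZ (c : R[i]) xi : normC (c *: xi) = `|c| * normC xi.
Proof. by rewrite /normC l2normZ rmorphM; case: c. Qed.

Let normC_eq0 xi : normC xi = 0 -> xi = 0.
Proof. by move=> /complexI; exact: l2norm_eq0. Qed.

HB.instance Definition _ := Lmodule_isNormed.Build R[i] (ell2 R X)
  normCD normCZ normC_eq0.

Lemma ell2_normE xi : `|xi| = (l2norm xi)%:C. Proof. by []. Qed.

End ell2_norm.


Section ell2_inner.
Context {R : realType} {X : choiceType}.
Implicit Types (A : set X) (x : X) (xi eta : ell2 R X).

(* Unordered sum of an absolutely summable family. *)
Definition rsum (f : X -> R) : R :=
  fine (\esum_(x in setT) (EFin \o f)^\+%E x)
  - fine (\esum_(x in setT) (EFin \o f)^\-%E x).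

Definition csum (f : X -> R[i]) : R[i] :=
  rsum (fun x => complex.Re (f x)) +i* rsum (fun x => complex.Im (f x)).

(* Linear in the first argument, conjugate-linear in the second. *)
Definition inner xi eta : R[i] := csum (fun x => xi x * (eta x)^*).

Lemma rsum_ge0 (f : X -> R) : (forall x, 0 <= f x) ->
  rsum f = fine (\esum_(x in setT) (f x)%:E).
Proof.
move=> f0; rewrite /rsum.
have -> : \esum_(x in setT) (EFin \o f)^\-%E x = 0%E.
  by rewrite esum1// => x _; rewrite funenegE/= max_r// lee_fin oppr_le0.
rewrite subr0; congr fine; apply: eq_esum => x _.
by rewrite funeposE/= max_l// lee_fin.
Qed.

Lemma rsum_supp1 (f : X -> R) x : (forall y, y != x -> f y = 0) ->
  rsum f = f x.
Proof.
move=> f0.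
have e (g : X -> \bar R) : (0 <= g x)%E -> (forall y, y != x -> g y = 0%E) ->
    \esum_(y in setT) g y = g x.
  move=> gx g0; rewrite -[RHS](@esum_set1 R X x g gx) [RHS]esum_mkcond.
  apply: eq_esum => y _.
  by case: ifPn => //; rewrite notin_setE/= => /eqP/g0.
rewrite /rsum !e ?funepos_ge0 ?funeneg_ge0//.
- rewrite funeposE funenegE/=; have [fx|/ltW fx] := leP 0 (f x).
    by rewrite max_l ?lee_fin// max_r ?lee_fin ?oppr_le0//= subr0.
  by rewrite max_r ?lee_fin// max_l ?lee_fin ?oppr_ge0//= sub0r opprK.
- by move=> y /f0 fy; rewrite funenegE/= fy oppr0 maxxx.
- by move=> y /f0 fy; rewrite funeposE/= fy maxxx.
Qed.

Lemma inner_self xi : inner xi xi = (l2norm xi ^+ 2)%:C.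
Proof.
have nE z : z * z^* = (normc z ^+ 2)%:C :> R[i].
  by rewrite -sqr_normc rmorphXn; case: z.
rewrite /inner /csum; congr (_ +i* _).
  rewrite rsum_ge0 => [|x]; last by rewrite nE/= sqr_ge0.
  have -> : l2norm xi ^+ 2 = fine (sumsq xi) by rewrite sumsqE.
  by congr fine; apply: eq_esum => x _; rewrite nE.
by rewrite rsum_ge0 => [|x]; rewrite ?nE// esum1// => x _; rewrite nE.
Qed.

Lemma sumsq_supp1 (f : X -> R[i]) x : (forall y, y != x -> f y = 0) ->
  sumsq f = (normc (f x) ^+ 2)%:E.
Proof.
move=> f0; have fx0 : (0 <= (normc (f x) ^+ 2)%:E)%E by rewrite lee_fin sqr_ge0.
rewrite -[RHS](@esum_set1 R X x (fun y => (normc (f y) ^+ 2)%:E) fx0).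
rewrite /sumsq [RHS]esum_mkcond; apply: eq_esum => y _.
by case: ifPn => //; rewrite notin_setE/= => /eqP/f0 ->; rewrite normc0 expr0n.
Qed.

Lemma delta_subproof x : (fun y => (y == x)%:R : R[i]) \in square_summable.
Proof.
rewrite /in_mem/= /square_summable (@sumsq_supp1 _ x) ?ltry// => y /negbTE ->.
by [].
Qed.

Definition delta x : ell2 R X := Ell2 (delta_subproof x).

Lemma restr_subproof A xi :
  (fun x => if x \in A then xi x else 0) \in square_summable.
Proof.
apply: le_lt_trans (ell2_valP xi); apply: le_esum => x _; rewrite lee_fin.
by case: ifP => // _; rewrite normc0 expr0n sqr_ge0.
Qed.

Definition chi A xi : ell2 R X := Ell2 (restr_subproof A xi).

Definition supp xi : set X := [set x | xi x != 0].

Lemma inner_delta xi x : inner xi (delta x) = xi x.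
Proof.
have dE y : xi y * (delta x y)^* = if y == x then xi y else 0.
  rewrite (_ : delta x y = (y == x)%:R)//.
  by case: (y == x); rewrite ?rmorph1 ?rmorph0 ?mulr1 ?mulr0.
rewrite /inner /csum !(@rsum_supp1 _ x) => [|y yx|y yx].
- by rewrite dE eqxx; case: (xi x).
- by rewrite dE (negbTE yx).
- by rewrite dE (negbTE yx).
Qed.

End ell2_inner.

Section operators.
Context {R : realType} {X : choiceType}.
Local Notation H := (ell2 R X).
Implicit Types (a p : H -> H).

Definition bounded_operator a :=
  linear a /\ exists M : R, forall xi, l2norm (a xi) <= M * l2norm xi.

(* The supremum is that of a nonempty bounded set when [a] is bounded. *)
Definition opnorm a : R :=
  sup [set l2norm (a xi) | xi in [set xi | l2norm xi <= 1]].

Definition entry a (x z : X) : R[i] := inner (a (delta z)) (delta x).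

Definition projection p :=
  [/\ bounded_operator p, forall xi, p (p xi) = p xi &
      forall xi eta, inner (p xi) eta = inner xi (p eta)].

Definition rank_one a := exists2 xi : H, xi != 0 &
  range a = [set c *: xi | c in [set: R[i]]].

Definition compact_operator a :=
  compact (closure (a @` [set xi : H | l2norm xi <= 1])).

End operators.

(* [ball x r] is the open ball; quantifying over all radii makes no difference. *)
Definition uniformly_locally_finite {R : realType} (X : metricType R) :=
  forall r : R, 0 < r -> exists N : nat, forall x : X, (ball x r #<= `I_N)%card.

Section Roe_algebra.
Context {R : realType} {X : metricType R}.
Local Notation H := (ell2 R X).
Implicit Types (a b p : H -> H).

(* In [diam] and [prop], the supremum of the empty set is -oo. *)
Definition diam (A : set X) : \bar R :=
  ereal_sup [set (mdist xy.1 xy.2)%:E | xy in A `*` A].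

Definition prop a : \bar R :=
  ereal_sup [set (mdist xy.1 xy.2)%:E |
             xy in [set xy : X * X | inner (a (delta xy.1)) (delta xy.2) != 0]].

Definition Roe : set (H -> H) :=
  [set a | bounded_operator a /\
    forall e : R, 0 < e ->
      exists b, [/\ bounded_operator b, (prop b < +oo)%E & opnorm (a \- b) <= e]].

Definition ghost a :=
  Roe a /\
  forall e : R, 0 < e ->
    exists2 A : set X, finite_set A &
      forall x z, ~ A x -> ~ A z -> normc (entry a x z) <= e.

Definition block_rank_one_projection p :=
  [/\ Roe p, projection p &
    exists Xn : nat -> set X,
      [/\ trivIset setT Xn,
          forall n, finite_set (Xn n) /\ Xn n !=set0,
          forall xi : H,
            (fun n => \sum_(k < n) chi (Xn k) (p (chi (Xn k) xi))) @ \oo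
              --> p xi &
          forall n, rank_one (chi (Xn n) \o p \o chi (Xn n))]].

Definition equi_approximable (S : set (H -> H)) :=
  S `<=` Roe /\
  forall e : R, 0 < e -> exists2 s : R, 0 < s &
    forall a, S a ->
      exists b, [/\ bounded_operator b, (prop b <= s%:E)%E & opnorm (a \- b) <= e].

End Roe_algebra.

Definition ONL_rank_one_projections {R : realType} (X : metricType R) :=
  forall (e : R) (S : set (ell2 R X -> ell2 R X)), 0 < e ->
    equi_approximable S ->
    (forall a, S a -> projection a /\ rank_one a) ->
    exists2 s : R, 0 < s &
      forall a, S a -> exists xi : ell2 R X,
        [/\ l2norm xi = 1, (diam (supp xi) <= s%:E)%E &
            (1 - e) * opnorm a <= l2norm (a xi)].

(* Main.v *)
(* A rank-one projection is [rank1 v = <., v> v] with [v] a unit vector, and its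
   best response on a unit vector supported in a set [A] is the norm of [v] on
   [A].

   If the block vectors [v_n] of a ghost satisfied ONL, each [v_n] would have
   norm at least 1/2 on a ball of fixed radius, hence on at most [N] points, so
   that some diagonal entry [|v_n x|^2] of the ghost would stay above a fixed
   bound.

   Conversely, suppose that an equi-approximable family fails ONL.  As [v] is
   proportional to [rank1 v (delta x)], a coefficient [|v x| >= c] forces [v] to
   be concentrated in a ball around [x] whose radius depends on [c] only, so the
   family contains [v] with arbitrarily small sup norm.  Truncations of such
   vectors to pairwise disjoint finite sets give an orthonormal sequence [w_k],
   and the sum of the [rank1 (w_k)] is the ghost: it is in the Roe algebra
   because the norm of a block diagonal operator is the supremum of the norms of
   its blocks. *)
Require Import Defs.
From HB Require Import structures.
From mathcomp Require Import all_boot all_order all_algebra.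
From mathcomp Require Import all_classical all_reals all_analysis.
From mathcomp Require Import finmap ring lra.
From mathcomp.real_closed Require Import complex.
Import Order.TTheory GRing.Theory Num.Theory.
Import numFieldNormedType.Exports.
Import ComplexField.Normc.

Set Implicit Arguments.
Unset Strict Implicit.
Unset Printing Implicit Defensive.

Local Open Scope classical_set_scope.
Local Open Scope complex_scope.
Local Open Scope ring_scope.

(** * Linearity of unordered sums of real and complex families *)

Section sums.
Context {R : realType} {X : choiceType}.
Implicit Types (f g : X -> R) (h k : X -> R[i]).

Definition rsummable f := summable setT (EFin \o f).

Lemma rsummable_le f g : (forall x, `|f x| <= g x) -> rsummable g ->
  rsummable f.
Proof.
move=> fg; apply: le_lt_trans; apply: le_esum => x _.
rewrite /= lee_fin; apply: le_trans (fg x) _; exact: ler_norm.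
Qed.


(** The positive part of [f]; the negative part is written [npart (fun x => - f x)]. Splitting into
    these two reduces the linearity of [rsum] to nonnegative families. *)
Definition npart f x : R := Num.max (f x) 0.

Lemma npart_ge0 f x : 0 <= npart f x.
Proof. by rewrite /npart le_max lexx orbT. Qed.

Lemma npart_le f x : npart f x <= `|f x|.
Proof. by rewrite /npart ge_max normr_ge0 ler_norm. Qed.

Lemma npartB f x : f x = npart f x - npart (fun x => - f x) x.
Proof. by rewrite /npart; case: (leP (f x) 0) => h; case: leP => ?; lra. Qed.

Lemma rsummable_npart f : rsummable f ->
  rsummable (npart f) /\ rsummable (npart (fun x => - f x)).
Proof.
move=> sf; have saf : rsummable (fun x => `|f x|).
  move: sf; rewrite /rsummable /summable; congr (_ < _)%E.
  by apply: eq_esum => x _; rewrite /= normr_id.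
split; apply: rsummable_le saf => x; rewrite ger0_norm ?npart_ge0//.
  exact: npart_le.
by rewrite -normrN; exact: npart_le.
Qed.

Lemma rsummableD f g : rsummable f -> rsummable g ->
  rsummable (fun x => f x + g x).
Proof. exact: summableD. Qed.

Lemma rsummable_fin f : rsummable f -> (forall x, 0 <= f x) ->
  (\esum_(x in setT) (f x)%:E)%E \is a fin_num.
Proof.
move=> sf f0; move: sf; rewrite /rsummable summableE.
congr (is_true (_ \is a fin_num)); apply: eq_esum => x _.
by rewrite /= ger0_norm.
Qed.

(** All sums involved are finite, so [fine] commutes with the subtraction in [esumB]. Hence [rsum]
    can be computed from any splitting into a difference of nonnegative summable families. *)
Lemma rsumB f g : rsummable f -> rsummable g ->
  (forall x, 0 <= f x) -> (forall x, 0 <= g x) ->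
  rsum (fun x => f x - g x) = rsum f - rsum g.
Proof.
move=> sf sg f0 g0; rewrite (rsum_ge0 f0) (rsum_ge0 g0) /rsum.
have sfg : summable setT ((EFin \o f) \- (EFin \o g))%E by exact: summableB.
have finp : (\esum_(x in setT) ((EFin \o f) \- (EFin \o g))^\+%E x)%E
    \is a fin_num.
  have := summable_funepos sfg; rewrite summableE.
  congr (is_true (_ \is a fin_num)).
  by apply: eq_esum => x _; rewrite gee0_abs// funepos_ge0.
have finn : (\esum_(x in setT) ((EFin \o f) \- (EFin \o g))^\-%E x)%E
    \is a fin_num.
  have := summable_funeneg sfg; rewrite summableE.
  congr (is_true (_ \is a fin_num)).
  by apply: eq_esum => x _; rewrite gee0_abs// funeneg_ge0.
have := @esumB R X setT (EFin \o f) (EFin \o g) sf sg.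
move=> /(_ (fun x _ => f0 x) (fun x _ => g0 x)) e.
by rewrite -fineB// -fineB ?rsummable_fin//; congr fine.
Qed.

Lemma rsum_npart f : rsummable f ->
  rsum f = rsum (npart f) - rsum (npart (fun x => - f x)).
Proof.
move=> /rsummable_npart[s1 s2]; rewrite -rsumB//; last 2 first.
- exact: npart_ge0.
- exact: npart_ge0.
by congr rsum; apply/funext => x; rewrite -npartB.
Qed.

Lemma rsumN f : rsummable f -> rsum (fun x => - f x) = - rsum f.
Proof.
move=> sf; rewrite (rsum_npart sf) rsum_npart; last first.
  by apply: le_lt_trans sf; apply: le_esum => x _; rewrite /= normrN.
rewrite [RHS]opprB; congr (_ - rsum _).
by apply/funext => x; rewrite /npart opprK.
Qed.

Lemma rsumD_ge0 f g : rsummable f -> rsummable g ->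
  (forall x, 0 <= f x) -> (forall x, 0 <= g x) ->
  rsum (fun x => f x + g x) = rsum f + rsum g.
Proof.
move=> sf sg f0 g0; rewrite !rsum_ge0// => [|x]; last exact: addr_ge0.
rewrite -fineD ?rsummable_fin// -esumD// => [x _|x _]; by rewrite lee_fin.
Qed.

Lemma rsumD f g : rsummable f -> rsummable g ->
  rsum (fun x => f x + g x) = rsum f + rsum g.
Proof.
move=> sf sg; rewrite (rsum_npart sf) (rsum_npart sg).
have [f1 f2] := rsummable_npart sf; have [g1 g2] := rsummable_npart sg.
have e a b c d : a - b + (c - d) = (a + c) - (b + d) :> R by ring.
rewrite e -!rsumD_ge0//; do ?by move=> ?; exact: npart_ge0.
rewrite -rsumB//; last 4 first.
- exact: rsummableD.
- exact: rsummableD.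
- by move=> x; rewrite addr_ge0// npart_ge0.
- by move=> x; rewrite addr_ge0// npart_ge0.
congr rsum; apply/funext => x.
by rewrite {1}(npartB f) {1}(npartB g) e.
Qed.

Lemma rsumZ_ge0 (c : R) f : 0 <= c -> (forall x, 0 <= f x) -> rsummable f ->
  rsum (fun x => c * f x) = c * rsum f.
Proof.
move=> c0 f0 sf; rewrite !rsum_ge0// => [|x]; last exact: mulr_ge0.
have [->|cn0] := eqVneq c 0.
  by rewrite mul0r esum1// => x _; rewrite mul0r.
have cp : 0 < c by rewrite lt_def cn0.
have f0E x : (0 <= (f x)%:E)%E by rewrite lee_fin.
rewrite -[c in RHS]/(fine c%:E) -fineM ?rsummable_fin//; congr fine.
apply/eqP; rewrite eq_le; apply/andP; split.
  by under eq_esum do rewrite EFinM; exact: esumZl_le.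
(* The reverse inequality is [esumZl_le] again, for the factor [c^-1]. *)
rewrite -lee_pdivlMl//; set S := esum _ _.
have -> : S = (\esum_(x in setT) (c^-1%:E * (c * f x)%:E))%E.
  by apply: eq_esum => x _; rewrite -EFinM mulrA mulVf// mul1r.
by apply: esumZl_le => [|x]; rewrite ?invr_ge0// lee_fin mulr_ge0.
Qed.

Lemma rsummableZ (c : R) f : rsummable f -> rsummable (fun x => c * f x).
Proof.
move=> sf; rewrite /rsummable /summable.
have : (\esum_(x in setT) (`|c|%:E * `|f x|%:E) <=
        `|c|%:E * \esum_(x in setT) `|f x|%:E)%E.
  by apply: esumZl_le => // x; rewrite lee_fin.
under eq_esum do rewrite -EFinM -normrM; move=> h.
apply: le_lt_trans h _; have := sf; rewrite /rsummable summableE => /fineK h.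
by rewrite -[X in (_ * X)%E]h -EFinM ltry.
Qed.

Lemma rsumZ (c : R) f : rsummable f -> rsum (fun x => c * f x) = c * rsum f.
Proof.
wlog c0 : c / 0 <= c => [hw sf|sf].
  have [/hw->//|/ltW c0] := leP 0 c.
  have := hw (- c); rewrite oppr_ge0 => /(_ c0 sf) h.
  rewrite -[RHS]opprK -mulNr -h -rsumN; last exact: rsummableZ.
  by congr rsum; apply/funext => x; rewrite mulNr opprK.
have [s1 s2] := rsummable_npart sf.
rewrite (rsum_npart sf) mulrBr -!rsumZ_ge0//; do ?by move=> ?; exact: npart_ge0.
rewrite -rsumB//; do ?by move=> ?; rewrite mulr_ge0 ?npart_ge0.
- by congr rsum; apply/funext => x; rewrite -mulrBr -npartB.
- exact: rsummableZ.
- exact: rsummableZ.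
Qed.

Definition csummable h :=
  rsummable (fun x => complex.Re (h x)) /\ rsummable (fun x => complex.Im (h x)).

Lemma csumD h k : csummable h -> csummable k ->
  csum (fun x => h x + k x) = csum h + csum k.
Proof.
move=> [h1 h2] [k1 k2]; rewrite /csum /=.
apply/eqP; rewrite eq_complex/= -!rsumD//.
by apply/andP; split; apply/eqP; congr rsum; apply/funext => x; rewrite raddfD.
Qed.

Lemma csumZ (c : R[i]) h : csummable h ->
  csum (fun x => c * h x) = c * csum h.
Proof.
move=> [h1 h2]; case: c => a b; apply/eqP; rewrite eq_complex/= -!rsumZ//.
have z1 u : rsummable (fun x => u * complex.Re (h x)) by exact: rsummableZ.
have z2 u : rsummable (fun x => u * complex.Im (h x)) by exact: rsummableZ.
rewrite -(rsumD (z2 a) (z1 b)) -(rsumN (z2 b)) -(rsumD (z1 a)); last first.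
  by under eq_fun do rewrite -mulNr; exact: z2.
by apply/andP; split; apply/eqP; congr rsum; apply/funext => x; case: (h x).
Qed.

Lemma csum_conj h : csummable h -> csum (fun x => conjc (h x)) = conjc (csum h).
Proof.
move=> [h1 h2]; apply/eqP; rewrite eq_complex/= -rsumN//.
by apply/andP; split; apply/eqP; congr rsum; apply/funext => x; case: (h x).
Qed.

End sums.

(** * The inner product of [ell2] and the truncations [chi] *)

Section inner_product.
Context {R : realType} {X : choiceType}.
Implicit Types (A B : set X) (xi eta zeta : ell2 R X).

Lemma mul_conjc (z : R[i]) : z * z^* = (normc z ^+ 2)%:C.
Proof. by rewrite -sqr_normc rmorphXn; case: z. Qed.

Lemma normc_conj (z : R[i]) : normc z^* = normc z.
Proof. by case: z => a b; rewrite /= sqrrN. Qed.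

Lemma normc_Re_le (z : R[i]) : `|complex.Re z| <= normc z.
Proof. by have := normc_ge_Re z; rewrite [X in _ <= X]normc_def lecR; case: z. Qed.

Lemma normc_Im_le (z : R[i]) : `|complex.Im z| <= normc z.
Proof.
have := normc_Re_le (z * 'i%C); rewrite ReiNIm normrN normcM /=.
by rewrite expr0n expr1n add0r sqrtr1 mulr1.
Qed.

Lemma rsummable_sumsq xi : rsummable (fun x => normc (xi x) ^+ 2).
Proof.
have := ell2_valP xi; rewrite /in_mem/= /square_summable /sumsq; apply: le_lt_trans.
by apply: le_esum => x _; rewrite /= ger0_norm ?sqr_ge0.
Qed.

Lemma csummable_inner xi eta : csummable (fun x => xi x * (eta x)^*).
Proof.
have s := rsummableD (rsummable_sumsq xi) (rsummable_sumsq eta).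
have le x : normc (xi x * (eta x)^*) <= normc (xi x) ^+ 2 + normc (eta x) ^+ 2.
  rewrite normcM normc_conj; set a := normc _; set b := normc (eta x).
  have := sqr_ge0 (a - b); have := sqr_ge0 (a + b); nra.
split; apply: rsummable_le s => x; apply: le_trans (le x).
  exact: normc_Re_le.
exact: normc_Im_le.
Qed.

Lemma innerDl xi eta zeta : inner (xi + eta) zeta = inner xi zeta + inner eta zeta.
Proof.
rewrite /inner -csumD; do ?exact: csummable_inner.
by congr csum; apply/funext => x; rewrite -mulrDl.
Qed.

Lemma innerZl c xi eta : inner (c *: xi) eta = c * inner xi eta.
Proof.
rewrite /inner -csumZ; do ?exact: csummable_inner.
by congr csum; apply/funext => x; rewrite mulrA.
Qed.

Lemma inner_conj xi eta : inner eta xi = (inner xi eta)^*.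
Proof.
rewrite -[RHS](csum_conj (csummable_inner xi eta)).
congr csum; apply/funext => x; rewrite -[RHS]/((xi x * (eta x)^* )^* ).
by rewrite rmorphM/= conjCK mulrC.
Qed.

Lemma innerDr xi eta zeta : inner zeta (xi + eta) = inner zeta xi + inner zeta eta.
Proof. by rewrite inner_conj innerDl rmorphD/= -!inner_conj. Qed.

Lemma innerZr c xi eta : inner xi (c *: eta) = c^* * inner xi eta.
Proof. by rewrite inner_conj innerZl rmorphM/= -!inner_conj. Qed.

Lemma innerBl xi eta zeta : inner (xi - eta) zeta = inner xi zeta - inner eta zeta.
Proof. by rewrite innerDl -scaleN1r innerZl mulN1r. Qed.

Lemma innerBr xi eta zeta : inner zeta (xi - eta) = inner zeta xi - inner zeta eta.
Proof. by rewrite inner_conj innerBl rmorphB/= -!inner_conj. Qed.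

Lemma inner0l eta : inner 0 eta = 0.
Proof. by rewrite -(scale0r 0) innerZl mul0r. Qed.

Lemma inner0r eta : inner eta 0 = 0.
Proof. by rewrite -(scale0r 0) innerZr conjC0 mul0r. Qed.

Lemma Cauchy_Schwarz xi eta : normc (inner xi eta) <= l2norm xi * l2norm eta.
Proof.
have [/l2norm_eq0->|n0] := eqVneq (l2norm eta) 0.
  by rewrite inner0r normc0 mulr_ge0 ?l2norm_ge0.
have np : 0 < l2norm eta by rewrite lt_def n0 l2norm_ge0.
set n := l2norm eta in n0 np *; set z := inner xi eta.
(* This vector is [n ^+ 2] times the component of [xi] orthogonal to [eta], a scaling that avoids
   division; its squared norm is [n ^+ 2 * (n ^+ 2 * l2norm xi ^+ 2 - normc z ^+ 2)]. *)
have := sqr_ge0 (l2norm ((n ^+ 2)%:C *: xi - z *: eta)); rewrite -lecR -inner_self.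
have cR (r : R) : (r%:C)^* = r%:C by exact: conjc_real.
rewrite !(innerBl, innerBr, innerZl, innerZr) cR (inner_conj xi eta) -/z.
rewrite !inner_self -/n.
have -> : forall a : R[i],
    (n ^+ 2)%:C * ((n ^+ 2)%:C * a) - (n ^+ 2)%:C * (z^* * z) -
    (z * ((n ^+ 2)%:C * z^*) - z * (z^* * (n ^+ 2)%:C)) =
    (n ^+ 2)%:C * ((n ^+ 2)%:C * a - z * z^*) by move=> a; ring.
rewrite mul_conjc -!rmorphM -rmorphB -rmorphM ler0c pmulr_rge0 ?exprn_gt0//.
rewrite subr_ge0 -exprMn mulrC ler_pXn2r ?nnegrE ?normc_ge0//.
by rewrite mulr_ge0 ?l2norm_ge0.
Qed.

Lemma l2normN xi : l2norm (- xi) = l2norm xi.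
Proof. by rewrite -scaleN1r l2normZ normcN normc1 mul1r. Qed.

Lemma l2normB xi eta : l2norm (xi - eta) = l2norm (eta - xi).
Proof. by rewrite -l2normN opprB. Qed.

Lemma l2normB_le xi eta : l2norm (xi - eta) <= l2norm xi + l2norm eta.
Proof. by rewrite (le_trans (l2normD _ _))// l2normN. Qed.

Lemma l2norm_ge_sub xi eta : l2norm xi - l2norm (xi - eta) <= l2norm eta.
Proof. by rewrite lerBlDr -{1}(subrK eta xi) addrC l2normD. Qed.

Lemma l2norm_mono xi eta : (forall x, normc (xi x) <= normc (eta x)) ->
  l2norm xi <= l2norm eta.
Proof.
move=> le; apply: l2norm_le; rewrite ?l2norm_ge0// -sumsqE.
apply: le_esum => x _; rewrite lee_fin ler_pXn2r ?nnegrE ?normc_ge0//.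
Qed.

Lemma ell2P xi eta : (forall x, xi x = eta x) -> xi = eta.
Proof. by move=> e; apply/val_inj/funext. Qed.

Lemma chiE A xi x : chi A xi x = if x \in A then xi x else 0.
Proof. by []. Qed.

Lemma chi_linear A : linear (chi A : ell2 R X -> ell2 R X).
Proof.
move=> c xi eta; apply/ell2P => x.
have e u v : (c *: u + v : ell2 R X) x = c * u x + v x by [].
by rewrite chiE !e !chiE; case: ifP; rewrite ?mulr0 ?addr0.
Qed.

Lemma l2norm_chi A xi : l2norm (chi A xi) <= l2norm xi.
Proof.
apply: l2norm_mono => x; rewrite chiE.
by case: ifP => // _; rewrite normc0 normc_ge0.
Qed.

Lemma chiI A B xi : chi A (chi B xi) = chi (A `&` B) xi.
Proof.
by apply/ell2P => x; rewrite !chiE in_setI; case: (x \in A); case: (x \in B).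
Qed.

Lemma chi0 xi : chi set0 xi = 0.
Proof. by apply/ell2P => x; rewrite chiE in_set0. Qed.

Lemma chiC A xi : xi - chi A xi = chi (~` A) xi.
Proof.
apply/ell2P => x; have -> : (xi - chi A xi) x = xi x - chi A xi x by [].
by rewrite !chiE in_setC; case: (x \in A); rewrite /= ?subrr ?subr0.
Qed.

Lemma inner_chi A xi eta : inner (chi A xi) eta = inner xi (chi A eta).
Proof.
congr csum; apply/funext => x; rewrite !chiE.
by case: ifP; rewrite ?conjC0 ?mulr0 ?mul0r.
Qed.

Lemma sqr_l2norm_chi A xi :
  ((l2norm (chi A xi) ^+ 2)%:E = \esum_(x in A) (normc (xi x) ^+ 2)%:E)%E.
Proof.
rewrite -sumsqE [RHS]esum_mkcond; apply: eq_esum => x _.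
by rewrite chiE; case: ifP => // _; rewrite normc0 expr0n.
Qed.

(** The squared norm is a sum of at most [N] terms. Small coefficients thus mean little mass on a
    set of bounded size, which serves both directions of the equivalence. *)
Lemma l2norm_chi_le A N xi (c : R) : 0 <= c -> (A #<= `I_N)%card ->
  (forall x, A x -> normc (xi x) ^+ 2 <= c) ->
  l2norm (chi A xi) ^+ 2 <= N%:R * c.
Proof.
move=> c0 AN xic; rewrite -lee_fin sqr_l2norm_chi.
have finA : finite_set A by exact: card_le_finite AN (finite_II N).
rewrite esum_fset//; last by move=> x _; rewrite lee_fin sqr_ge0.
apply: (@le_trans _ _ (\sum_(x \in A) c%:E)%E).
  by apply: lee_fsum => // x Ax; rewrite lee_fin; exact: xic.
rewrite fsbig_finite//= sumEFin lee_fin big_const_seq count_predT.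
rewrite iter_addr_0 -[leLHS]mulr_natl ler_wpM2r// ler_nat.
exact: geq_card_fset_set.
Qed.

(** A finite partial sum comes within [e ^+ 2] of [sumsq xi], and what it misses is the squared norm
    off [F]. *)
Lemma l2norm_tail xi (e : R) : 0 < e ->
  exists2 F : set X, finite_set F & l2norm (chi (~` F) xi) <= e.
Proof.
move=> e0; have e20 : 0 < e ^+ 2 by rewrite exprn_gt0.
have fin := square_summable_fin (ell2_valP xi).
have [_ [F [finF _] <-]] := ub_ereal_sup_adherent e20 fin.
rewrite -/(sumsq xi) -(esum_fset finF); last by move=> x _; rewrite lee_fin sqr_ge0.
move=> lt; exists F => //.
rewrite -(@ler_pXn2r _ 2) ?nnegrE ?l2norm_ge0 ?(ltW e0)//.
rewrite -lee_fin sqr_l2norm_chi.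
move: lt; rewrite -/(esum _ _) (esumID F); last by move=> x _; rewrite lee_fin sqr_ge0.
rewrite !setTI -!sqr_l2norm_chi => lt.
have {lt} := lt; rewrite -!EFinD lte_fin lee_fin; lra.
Qed.

Lemma l2norm_delta x : l2norm (delta x : ell2 R X) = 1.
Proof.
have := @sumsqE R X (delta x); rewrite (@sumsq_supp1 _ _ _ x) => [|y /negbTE yx].
  rewrite (_ : delta x x = 1); last by rewrite /= /delta /= eqxx.
  rewrite normc1 expr1n => -[] /esym/eqP; rewrite sqrf_eq1 => /orP[/eqP//|/eqP h].
  by have := l2norm_ge0 (delta x : ell2 R X); rewrite h; lra.
by rewrite /delta /= yx.
Qed.

End inner_product.

(** * Operator norm and rank-one projections *)

Section bounded_operators.
Context {R : realType} {X : choiceType}.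
Local Notation H := (ell2 R X).
Implicit Types (a b : H -> H) (xi eta v : H) (A : set X).

Lemma linear_op0 a : linear a -> a 0 = 0.
Proof.
move=> la; have := la (-1) 0 0; rewrite scaler0 addr0 scaleN1r => h.
by rewrite h addNr.
Qed.

Lemma linear_opZ a c xi : linear a -> a (c *: xi) = c *: a xi.
Proof. by move=> la; rewrite -[c *: xi]addr0 la linear_op0// addr0. Qed.

Lemma bounded_operator_ge0 a : bounded_operator a ->
  exists2 M : R, 0 <= M & forall xi, l2norm (a xi) <= M * l2norm xi.
Proof.
move=> [_ [M aM]]; exists `|M| => // xi; apply: le_trans (aM xi) _.
by rewrite ler_wpM2r ?l2norm_ge0// ler_norm.
Qed.

Lemma l2norm_gt0 xi : xi != 0 -> 0 < l2norm xi.
Proof.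
move=> n0; rewrite lt_def l2norm_ge0 andbT.
by apply: contra n0 => /eqP/l2norm_eq0 ->.
Qed.

Lemma normc_real (t : R) : normc t%:C = `|t|.
Proof. by rewrite /= expr0n addr0 sqrtr_sqr. Qed.

Lemma l2norm_opnorm a xi : bounded_operator a ->
  l2norm (a xi) <= opnorm a * l2norm xi.
Proof.
move=> ba; have [la _] := ba; have [M M0 aM] := bounded_operator_ge0 ba.
have [->|n0] := eqVneq xi 0; first by rewrite linear_op0// l2norm0 mulr0.
have np := l2norm_gt0 n0; rewrite -ler_pdivrMr//; set t := (l2norm xi)^-1.
have nt : normc t%:C = t by rewrite normc_real ger0_norm// invr_ge0 ltW.
have -> : l2norm (a xi) * t = l2norm (a (t%:C *: xi)).
  by rewrite linear_opZ// l2normZ nt mulrC.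
apply: ub_le_sup; last first.
  by exists (t%:C *: xi) => //=; rewrite l2normZ nt mulVf// gt_eqF.
exists M => _ [eta /= n1 <-]; apply: le_trans (aM eta) _.
by rewrite ler_piMr.
Qed.

Lemma opnorm_le a (e : R) : 0 <= e ->
  (forall xi, l2norm (a xi) <= e * l2norm xi) -> opnorm a <= e.
Proof.
move=> e0 h; apply: ge_sup.
  by exists (l2norm (a 0)), 0 => //=; rewrite l2norm0 ler01.
by move=> _ [eta /= n1 <-]; apply: le_trans (h eta) _; rewrite ler_piMr.
Qed.

Lemma bounded_operatorB a b : bounded_operator a -> bounded_operator b ->
  bounded_operator (a \- b).
Proof.
move=> [la [M aM]] [lb [N bN]]; split.
  by move=> c u v /=; rewrite la lb scalerBr addrACA opprD.
exists (M + N) => xi; apply: le_trans (l2normB_le _ _) _.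
by rewrite mulrDl lerD.
Qed.

Lemma opnormB_le a b (e : R) xi : bounded_operator a -> bounded_operator b ->
  opnorm (a \- b) <= e -> l2norm (a xi - b xi) <= e * l2norm xi.
Proof.
move=> ba bb abe; apply: le_trans (l2norm_opnorm xi (bounded_operatorB ba bb)) _.
by rewrite ler_wpM2r ?l2norm_ge0.
Qed.

Definition rank1 v xi := inner xi v *: v.

Lemma linear_rank1 v : linear (rank1 v).
Proof. by move=> c u w; rewrite /rank1 innerDl innerZl scalerDl scalerA. Qed.

Lemma l2norm_rank1 v xi : l2norm v = 1 -> l2norm (rank1 v xi) = normc (inner xi v).
Proof. by move=> v1; rewrite l2normZ v1 mulr1. Qed.

Lemma l2norm_rank1_le v xi : l2norm v = 1 -> l2norm (rank1 v xi) <= l2norm xi.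
Proof.
by move=> v1; rewrite l2norm_rank1//; have := Cauchy_Schwarz xi v; rewrite v1 mulr1.
Qed.

Lemma bounded_rank1 v : l2norm v = 1 -> bounded_operator (rank1 v).
Proof.
move=> v1; split; first exact: linear_rank1.
by exists 1 => xi; rewrite mul1r; exact: l2norm_rank1_le.
Qed.

Lemma inner_unit v : l2norm v = 1 -> inner v v = 1.
Proof. by move=> v1; rewrite inner_self v1 expr1n. Qed.

Lemma rank1_id v : l2norm v = 1 -> rank1 v v = v.
Proof. by move=> v1; rewrite /rank1 inner_unit// scale1r. Qed.

Lemma inner_rank1 v xi eta : inner (rank1 v xi) eta = inner xi (rank1 v eta).
Proof. by rewrite innerZl innerZr mulrC -inner_conj mulrC. Qed.

Lemma rank1_idem v xi : l2norm v = 1 -> rank1 v (rank1 v xi) = rank1 v xi.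
Proof. by move=> v1; rewrite /rank1 innerZl inner_unit// mulr1. Qed.

Lemma opnorm_rank1 v : l2norm v = 1 -> opnorm (rank1 v) = 1.
Proof.
move=> v1; apply/eqP; rewrite eq_le; apply/andP; split.
  by apply: opnorm_le => // xi; rewrite mul1r l2norm_rank1_le.
by have := l2norm_opnorm v (bounded_rank1 v1); rewrite rank1_id// v1 mulr1.
Qed.

Definition normalize xi : H := ((l2norm xi)^-1)%:C *: xi.

Lemma l2norm_normalize xi : xi != 0 -> l2norm (normalize xi) = 1.
Proof.
move=> /l2norm_gt0 n0.
by rewrite l2normZ normc_real ger0_norm ?mulVf ?gt_eqF// invr_ge0 ltW.
Qed.

Lemma rank_one_rank1 v : l2norm v = 1 -> rank_one (rank1 v).
Proof.
move=> v1; exists v.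
  by apply/eqP => v0; move: v1; rewrite v0 l2norm0 => /eqP; rewrite eq_sym oner_eq0.
apply/seteqP; split => _ [u _ <-]; first by exists (inner u v).
by exists (u *: v) => //; rewrite /rank1 innerZl inner_unit// mulr1.
Qed.

(* [<a xi, v> = <xi, a v> = <xi, v>] identifies the coefficient of [a xi]. *)
Lemma rank_one_projectionP a : projection a -> rank_one a ->
  exists2 v, l2norm v = 1 & a = rank1 v.
Proof.
move=> [[la _] aa asa] [xi0 n0 ran]; exists (normalize xi0).
  exact: l2norm_normalize.
set v := normalize xi0; have v1 : l2norm v = 1 by exact: l2norm_normalize.
have ax0 : a xi0 = xi0.
  have [u _ <-] : range a xi0 by rewrite ran; exists 1; rewrite ?scale1r.
  exact: aa.
have av : a v = v by rewrite linear_opZ// ax0.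
apply/funext => xi; have [c _ cE] : [set c *: xi0 | c in [set: R[i]]] (a xi).
  by rewrite -ran; exists xi.
have xi0E : xi0 = (l2norm xi0)%:C *: v.
  rewrite scalerA -rmorphM mulfV ?scale1r//.
  by rewrite gt_eqF// l2norm_gt0.
have dE : a xi = (c * (l2norm xi0)%:C) *: v by rewrite -scalerA -xi0E.
have e : inner xi v = c * (l2norm xi0)%:C.
  by rewrite -av -asa dE innerZl inner_unit// mulr1.
by rewrite /rank1 e dE.
Qed.

Lemma entryE a x z : entry a x z = a (delta z) x.
Proof. exact: inner_delta. Qed.

Lemma rank1_delta v x : rank1 v (delta x) = (v x)^* *: v.
Proof. by rewrite /rank1 inner_conj inner_delta. Qed.

End bounded_operators.

(** * Block diagonal operators *)

Section blocks.
Context {R : realType} {X : choiceType}.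
Local Notation H := (ell2 R X).
Implicit Types (a : H -> H) (b : nat -> H -> H) (xi eta v : H) (A : set X).

Definition compress A a := chi A \o a \o chi A.

Lemma ell2DE xi eta x : (xi + eta) x = xi x + eta x. Proof. by []. Qed.
Lemma ell2BE xi eta x : (xi - eta) x = xi x - eta x. Proof. by []. Qed.
Lemma ell2ZE (c : R[i]) xi x : (c *: xi) x = c * xi x. Proof. by []. Qed.

Lemma chi_delta A x : chi A (delta x) = if x \in A then delta x else 0 :> H.
Proof.
apply: ell2P => y; rewrite chiE; case: ifP => yA; case: ifP => xA //.
- rewrite [LHS](_ : _ = (y == x)%:R)//.
  by case: eqP => // yx; rewrite -yx yA in xA.
- rewrite [RHS](_ : _ = (y == x)%:R)//.
  by case: eqP => // yx; rewrite yx xA in yA.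
Qed.

Lemma compressE A a xi : compress A a xi = chi A (a (chi A xi)). Proof. by []. Qed.

Lemma linear_compress A a : linear a -> linear (compress A a).
Proof. by move=> la c u v; rewrite !compressE chi_linear la chi_linear. Qed.

Lemma bounded_compress A a : bounded_operator a -> bounded_operator (compress A a).
Proof.
move=> ba; have [M M0 aM] := bounded_operator_ge0 ba.
split; first by apply: linear_compress; case: ba.
exists M => xi; apply: le_trans (l2norm_chi _ _) _.
by apply: le_trans (aM _) _; rewrite ler_wpM2l// l2norm_chi.
Qed.

Variable Y : nat -> set X.
Hypothesis disjY : trivIset setT Y.

(** [k] is the index of the block containing [x]. Off all blocks it takes the default value 0, and
    the truncation to [Y 0] then gives 0. The sum over all blocks is thus defined pointwise, without
    a limit. *)
Definition block_fun b xi x :=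
  let k := xget 0%N [set k | Y k x] in compress (Y k) (b k) xi x.

(* Junk value [0] if the family is not uniformly bounded. *)
Definition block b xi : H := insubd 0 (block_fun b xi).

Lemma block_fun_in b xi k x : Y k x -> block_fun b xi x = b k (chi (Y k) xi) x.
Proof.
move=> Ykx; rewrite /block_fun; case: xgetP => [j _ Yjx|/(_ k)//].
have -> : j = k by apply: (disjY (i := j) (j := k)) => //; exists x.
by rewrite compressE chiE mem_set.
Qed.

Lemma block_fun_out b xi x : ~ (\bigcup_k Y k) x -> block_fun b xi x = 0.
Proof.
move=> nY; rewrite /block_fun compressE chiE memNset// => Yx.
by apply: nY; eexists; last exact: Yx.
Qed.

Variables (b : nat -> H -> H) (M : R).
Hypothesis M0 : 0 <= M.
Hypothesis bM : forall k xi, l2norm (b k xi) <= M * l2norm xi.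

(** On [Y k] the output depends on [chi (Y k) xi] alone, so block [k] contributes at most [M ^+ 2]
    times the mass of [xi] there; by disjointness these masses add up to at most [sumsq xi]. *)
Lemma sumsq_block xi : (sumsq (block_fun b xi) <= (M ^+ 2)%:E * sumsq xi)%E.
Proof.
have sq0 (z : R[i]) : (0 <= (normc z ^+ 2)%:E)%E by rewrite lee_fin sqr_ge0.
rewrite /sumsq (esumID (\bigcup_k Y k)); last by move=> x _; exact: sq0.
rewrite [X in (_ + X)%E]esum1 ?adde0 => [|x [_ nx]]; last first.
  by rewrite block_fun_out// normc0 expr0n.
rewrite setTI esum_bigcupT//.
apply: (@le_trans _ _ (\esum_(k in [set: nat])
    ((M ^+ 2)%:E * \esum_(x in Y k) (normc (xi x) ^+ 2)%:E))%E).
  apply: le_esum => k _; rewrite -sqr_l2norm_chi -EFinM -exprMn.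
  apply: (@le_trans _ _ (l2norm (chi (Y k) (b k (chi (Y k) xi))) ^+ 2)%:E).
    rewrite sqr_l2norm_chi; apply: le_esum => x Yx.
    by rewrite (block_fun_in _ _ Yx).
  rewrite lee_fin ler_pXn2r ?nnegrE ?mulr_ge0 ?l2norm_ge0//.
  by apply: le_trans (l2norm_chi _ _) _; exact: bM.
apply: le_trans (esumZl_le _ _) _; first exact: sqr_ge0.
  by move=> k; apply: esum_ge0 => x _; exact: sq0.
rewrite lee_wpmul2l ?lee_fin ?sqr_ge0// -esum_bigcupT//.
rewrite [leRHS](esumID (\bigcup_k Y k)); last by move=> x _; exact: sq0.
by rewrite setTI leeDl// esum_ge0.
Qed.

Lemma blockE xi x : block b xi x = block_fun b xi x.
Proof.
have s : block_fun b xi \in square_summable.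
  apply: le_lt_trans (sumsq_block xi) _.
  by rewrite sumsqE -EFinM ltry.
by rewrite -[block b xi x]/(val (insubd 0 _) x) /block insubdK.
Qed.

Lemma block_in xi k x : Y k x -> block b xi x = b k (chi (Y k) xi) x.
Proof. by rewrite blockE; exact: block_fun_in. Qed.

Lemma block_out xi x : ~ (\bigcup_k Y k) x -> block b xi x = 0.
Proof. by rewrite blockE; exact: block_fun_out. Qed.

Lemma chi_block k xi : chi (Y k) (block b xi) = compress (Y k) (b k) xi.
Proof.
apply: ell2P => x; rewrite chiE; case: ifPn => [|/negP] Yx.
  by rewrite (block_in _ (set_mem Yx)) compressE chiE Yx.
by rewrite compressE chiE ifN//; exact/negP.
Qed.

Lemma l2norm_block xi : l2norm (block b xi) <= M * l2norm xi.
Proof.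
apply: l2norm_le; rewrite ?mulr_ge0 ?l2norm_ge0//.
rewrite exprMn EFinM -sumsqE; apply: le_trans (sumsq_block xi).
by apply: le_esum => x _; rewrite blockE.
Qed.

Lemma linear_block : (forall k, linear (b k)) -> linear (block b).
Proof.
move=> lb c xi eta; apply: ell2P => x.
rewrite ell2DE ell2ZE !blockE /block_fun.
by rewrite linear_compress ?ell2DE ?ell2ZE.
Qed.

Lemma bounded_block : (forall k, linear (b k)) -> bounded_operator (block b).
Proof. by move=> lb; split; [exact: linear_block|exists M; exact: l2norm_block]. Qed.

End blocks.

(** * Propagation, diameter and norm convergence *)

Section metric.
Context {R : realType} {X : metricType R}.
Local Notation H := (ell2 R X).
Implicit Types (a b p : H -> H) (xi eta v : H) (A : set X).

Lemma prop_leP a (s : R) : (prop a <= s%:E)%E <->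
  forall x y, a (delta x) y != 0 -> mdist x y <= s.
Proof.
split=> [as_ x y axy|as_].
  rewrite -lee_fin; apply: le_trans as_; apply: ereal_sup_ubound.
  by exists (x, y) => //=; rewrite inner_delta.
apply: ge_ereal_sup => _ [[x y] /= + <-]; rewrite inner_delta lee_fin.
exact: as_.
Qed.

Lemma diam_leP A (s : R) : (diam A <= s%:E)%E <->
  forall x y, A x -> A y -> mdist x y <= s.
Proof.
split=> [As x y Ax Ay|As].
  by rewrite -lee_fin; apply: le_trans As; apply: ereal_sup_ubound; exists (x, y).
by apply: ge_ereal_sup => _ [[x y] /= [Ax Ay] <-]; rewrite lee_fin As.
Qed.

(** Each entry of the compression is 0 or the corresponding entry of [a]. *)
Lemma prop_compress A a (s : R) : linear a ->
  (prop a <= s%:E)%E -> (prop (compress A a) <= s%:E)%E.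
Proof.
move=> la /prop_leP as_; apply/prop_leP => x y.
rewrite compressE chi_delta chiE; case: ifP => [yA|]; last by rewrite eqxx.
case: ifP => [xA|_]; first exact: as_.
by rewrite linear_op0// eqxx.
Qed.

Lemma l2norm_compressB A a b (e : R) xi : 0 <= e ->
  (forall xi, l2norm (a xi - b xi) <= e * l2norm xi) ->
  l2norm (compress A a xi - compress A b xi) <= e * l2norm xi.
Proof.
move=> e0 ab; rewrite !compressE.
have -> : chi A (a (chi A xi)) - chi A (b (chi A xi)) =
    chi A (a (chi A xi) - b (chi A xi)).
  apply: ell2P => x; rewrite !(chiE, ell2BE).
  by case: ifP; rewrite ?subrr.
apply: le_trans (l2norm_chi _ _) _; apply: le_trans (ab _) _.
by rewrite ler_wpM2l// l2norm_chi.
Qed.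

Lemma opnormB_leP a b (e : R) : 0 <= e ->
  bounded_operator a -> bounded_operator b ->
  opnorm (a \- b) <= e <-> forall xi, l2norm (a xi - b xi) <= e * l2norm xi.
Proof.
move=> e0 ba bb; split=> [h xi|h]; first exact: opnormB_le.
exact: opnorm_le.
Qed.

(** The norm of [ell2] takes values in [R[i]], where a positive radius is a positive real part with
    imaginary part 0; the lemma passes to radii in [R]. *)
Lemma cvg_l2normP (f : nat -> H) xi : (f @ \oo --> xi) <->
  forall e : R, 0 < e -> exists N : nat, forall n, (N <= n)%N ->
    l2norm (xi - f n) <= e.
Proof.
split=> [/cvgrPdist_le fxi e e0|fxi].
  have /fxi[N _ h] : 0 < e%:C by rewrite ltcR.
  by exists N => n Nn; have := h n Nn; rewrite ell2_normE lecR.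
apply/cvgrPdist_le => e; rewrite ltcE/= => /andP[/eqP e_im e_re].
have [N h] := fxi _ e_re; exists N => // n /= /h.
by rewrite ell2_normE lecE/= e_im eqxx.
Qed.

Lemma cvg_l2norm_eq (f : nat -> H) xi eta (N : nat) : f @ \oo --> xi ->
  (forall n, (N <= n)%N -> f n = eta) -> xi = eta.
Proof.
move=> /cvg_l2normP fxi feta; apply/subr0_eq/l2norm_eq0/eqP.
rewrite eq_le l2norm_ge0 andbT; apply/ler_addgt0Pl => e e0; rewrite addr0.
have [M h] := fxi _ e0; have := h (maxn N M) (leq_maxr _ _).
by rewrite feta// leq_maxl.
Qed.

(** Each point of [A] lies in at most one set [Y k], and any index beyond all of these works. A
    point in none has the default index 0, which does no harm. *)
Lemma trivIset_avoid_finite (Y : nat -> set X) A : trivIset setT Y ->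
  finite_set A -> exists K : nat, forall n, (K <= n)%N -> Y n `&` A = set0.
Proof.
move=> disjY finA; pose k x := xget 0%N [set k | Y k x].
exists (\max_(x <- fset_set A) (k x).+1)%N => n Kn.
apply/seteqP; split=> // x [Yx Ax].
have kx : k x = n.
  rewrite /k; case: xgetP => [j _ Yjx|/(_ n)//].
  by apply: (disjY j n) => //; exists x.
have : ((k x).+1 <= \max_(x <- fset_set A) (k x).+1)%N.
  by apply: leq_bigmax_seq => //; rewrite in_fset_set// mem_set.
by rewrite kx leqNgt ltnS Kn.
Qed.

Lemma prop_lt_pinfty a : (prop a < +oo)%E -> exists2 s : R, 0 < s & (prop a <= s%:E)%E.
Proof.
case: (prop a) => [r _|//|_]; last by exists 1; rewrite ?leNye.
exists (`|r| + 1); first by rewrite ltr_wpDl.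
by rewrite lee_fin ler_wpDr// ler_norm.
Qed.

End metric.

(** * ONL excludes block-rank-one ghost projections *)

Section no_ghost.
Context {R : realType} {X : metricType R}.
Local Notation H := (ell2 R X).
Variables (p : H -> H) (Y : nat -> set X).
Hypotheses (Rp : Roe p) (pp : projection p) (disjY : trivIset setT Y).
Hypothesis pY : forall xi : H,
  (fun n => \sum_(k < n) chi (Y k) (p (chi (Y k) xi))) @ \oo --> p xi.

(** On a vector supported in [Y n] only the [n]-th term of the series survives, so the partial sums
    are constant from [n.+1] terms on. *)
Lemma block_projection_chi n xi : p (chi (Y n) xi) = compress (Y n) p xi.
Proof.
have [[lp _] _ _] := pp; apply: (cvg_l2norm_eq (N := n.+1) (pY (xi:=_))) => m nm.
rewrite (bigD1 (Ordinal nm))//= [X in _ + X]big1 => [|k kn].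
  by rewrite addr0 chiI setIid.
have -> : chi (Y k) (chi (Y n) xi) = 0.
  rewrite chiI; have -> : Y k `&` Y n = set0; last exact: chi0.
  apply: contra_neq_eq kn => /set0P Ykn; apply/val_inj => /=.
  exact: disjY.
rewrite linear_op0//; apply: linear_op0; exact: chi_linear.
Qed.

(** A compression of a projection need not be idempotent; this one is because [p] maps vectors
    supported in [Y n] to vectors supported in [Y n]. *)
Lemma projection_compress n : projection (compress (Y n) p).
Proof.
have [bp idp sap] := pp; split; first exact: bounded_compress.
  move=> xi; have e : chi (Y n) (compress (Y n) p xi) = compress (Y n) p xi.
    by rewrite compressE chiI setIid.
  by rewrite {1}compressE e -block_projection_chi idp block_projection_chi e.
by move=> xi eta; rewrite !compressE inner_chi sap inner_chi.
Qed.

(** Compression increases neither propagation nor distance, so the compressions of a single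
    approximant of [p] serve all blocks with the same [s]. *)
Lemma equi_approximable_compress :
  equi_approximable [set compress (Y n) p | n in [set: nat]].
Proof.
have [bp app] := Rp; have [lp _] := bp.
have approx n b (e s : R) : 0 <= e -> bounded_operator b ->
    (prop b <= s%:E)%E -> opnorm (p \- b) <= e ->
    [/\ bounded_operator (compress (Y n) b), (prop (compress (Y n) b) <= s%:E)%E &
        opnorm (compress (Y n) p \- compress (Y n) b) <= e].
  move=> e0 bb bs pb; split; [exact: bounded_compress| |].
    by apply: prop_compress => //; case: bb.
  apply/opnormB_leP => //; do ?exact: bounded_compress.
  by move=> xi; apply: l2norm_compressB => //; exact/opnormB_leP.
split=> [_ [n _ <-]|e e0].
  split; first exact: bounded_compress.
  move=> e e0; have [b [bb /prop_lt_pinfty[s _ bs] pb]] := app e e0.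
  have [b1 b2 b3] := approx n b e s (ltW e0) bb bs pb.
  by exists (compress (Y n) b); split => //; apply: le_lt_trans b2 (ltry _).
have [b [bb /prop_lt_pinfty[s s0 bs] pb]] := app e e0.
exists s => // _ [n _ <-]; exists (compress (Y n) b).
exact: approx (ltW e0) bb bs pb.
Qed.

Lemma block_rank_one_not_ghost : uniformly_locally_finite X ->
  (forall n, rank_one (compress (Y n) p)) ->
  ONL_rank_one_projections X -> ~ ghost p.
Proof.
move=> ulf rk onl [_ gh].
have half0 : 0 < 2^-1 :> R by lra.
have [] := onl _ _ half0 equi_approximable_compress.
  by move=> _ [n _ <-]; split; [exact: projection_compress|exact: rk].
(* [ball] is open: the radius [s + 1] makes it contain every point within distance [s]. *)
move=> s s0 loc; have [|N ballN] := ulf (s + 1); first lra.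
(* ONL with error 1/2 will give squared norm at least 1/4 on a ball, whereas [N] coefficients with
   squares at most [e] give at most 1/8; [N.+1] avoids a division by 0. *)
pose e : R := (8 * N.+1%:R)^-1.
have N0 : 0 < N.+1%:R :> R by rewrite ltr0n.
have e0 : 0 < e by rewrite invr_gt0 mulr_gt0.
have [A finA small] := gh _ e0.
have [n /(_ _ (leqnn n)) YnA] := trivIset_avoid_finite disjY finA.
have [v v1 pv] := rank_one_projectionP (projection_compress n) (rk n).
(* The square is a diagonal entry of the block: 0 off [Y n], and on [Y n] an entry of [p] at a point
   outside [A]. *)
have v_small x : normc (v x) ^+ 2 <= e.
  have -> : normc (v x) ^+ 2 = normc (compress (Y n) p (delta x) x).
    by rewrite pv rank1_delta ell2ZE normcM normc_conj.
  rewrite compressE chi_delta chiE.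
  case: ifPn => [/set_mem Yx|_]; last by rewrite normc0 ltW.
  have nAx : ~ A x.
    by move=> Ax; have YA : (Y n `&` A) x by []; rewrite YnA in YA.
  by rewrite mem_set// -entryE; apply: small.
have [xi [xi1 /diam_leP dxi]] := loc _ (ex_intro2 _ _ n Logic.I erefl).
rewrite pv opnorm_rank1// mulr1 l2norm_rank1// => le_xi.
have [x0 x0xi] : supp xi !=set0.
  apply/set0P/eqP => s0'; have xi0 : xi = 0.
    apply: ell2P => x; apply/eqP/negPn/negP => xix.
    by have : supp xi x by []; rewrite s0'.
  by move: xi1; rewrite xi0 l2norm0; lra.
have xiB : chi (ball x0 (s + 1)) xi = xi.
  apply: ell2P => x; rewrite chiE; case: ifPn => // xB.
  apply/esym/eqP/negPn/negP => xix; move/negP: xB; apply; apply/mem_set.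
  by rewrite ballEmdist/=; have := dxi _ _ x0xi xix; lra.
have := @l2norm_chi_le R X _ N v e (ltW e0) (ballN x0) (fun x _ => v_small x).
(* As [xi] is supported in the ball, its pairing with [v] only sees [v] there, so the response at
   [xi] is at most the norm of [v] on the ball. *)
have := Cauchy_Schwarz xi (chi (ball x0 (s + 1)) v).
rewrite -inner_chi xiB xi1 mul1r.
set t := l2norm _; set u := normc _ in le_xi *; move=> ut tN.
have Ne : N%:R * e <= 8^-1.
  rewrite /e invfM mulrCA ger_pMr// ler_pdivrMr// mul1r ler_nat; exact: leqnSn.
nra.
Qed.

End no_ghost.

(** * Vectors with small coefficients in a family that fails ONL *)

Section delocalized_vectors.
Context {R : realType} {X : metricType R}.
Local Notation H := (ell2 R X).
Implicit Types (a b p : H -> H) (xi eta v w : H) (A F : set X).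

Lemma finite_mdist_bounded F : finite_set F ->
  exists2 s : R, 0 < s & forall x y, F x -> F y -> mdist x y <= s.
Proof.
move=> finF.
pose d (xy : X * X) : R := mdist xy.1 xy.2.
(* The sum of all distances within [F] bounds each of them; adding 1 makes the bound positive. *)
exists (1 + \sum_(z <- fset_set (F `*` F)) d z).
  by rewrite ltr_pwDl// sumr_ge0// => z _; exact: mdist_ge0.
move=> x y Fx Fy; rewrite ler_wpDl//.
have xyF : (x, y) \in fset_set (F `*` F).
  by rewrite in_fset_set; [exact/mem_set|exact: finite_setX].
rewrite (big_fsetD1 _ xyF)/= [d _]/(mdist x y) lerDl sumr_ge0// => z _.
exact: mdist_ge0.
Qed.

(* [rank1 v (delta x)] is the multiple [(v x)^* *: v] of [v], and it is close to
   [b (delta x)], which is supported near [x]. *)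
Lemma localization_near_point v b (c e s : R) x : l2norm v = 1 ->
  0 < c -> 0 <= e -> bounded_operator b -> (prop b <= s%:E)%E ->
  opnorm (rank1 v \- b) <= e * c -> c <= normc (v x) ->
  l2norm (chi (~` [set y | mdist x y <= s]) v) <= e.
Proof.
move=> v1 c0 e0 bb /prop_leP bs vb cv; set A := [set y | _].
have : l2norm (chi (~` A) (rank1 v (delta x) - b (delta x))) <= e * c.
  apply: le_trans (l2norm_chi _ _) _.
  have := opnormB_le (delta x) (bounded_rank1 v1) bb vb.
  by rewrite l2norm_delta mulr1.
have -> : chi (~` A) (rank1 v (delta x) - b (delta x)) = (v x)^* *: chi (~` A) v.
  apply: ell2P => y; rewrite rank1_delta chiE !(ell2ZE, ell2BE) chiE in_setC.
  case: ifPn => [|_]; last by rewrite mulr0.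
  rewrite notin_setE => yA; rewrite -[RHS]subr0; congr (_ - _); apply/eqP/negPn/negP.
  by move=> /bs.
rewrite l2normZ normc_conj => h; rewrite -(ler_pM2r c0); apply: le_trans h.
by rewrite mulrC ler_wpM2r ?l2norm_ge0.
Qed.

(** For a unit vector [v], [rank1 v] thus sends the normalized truncation to a vector of norm
    [l2norm (chi A v)], which makes this truncation the witness for ONL. *)
Lemma inner_normalize_chi A v : chi A v != 0 ->
  inner (normalize (chi A v)) v = (l2norm (chi A v))%:C.
Proof.
move=> /l2norm_gt0 n0; rewrite /normalize innerZl.
have -> : inner (chi A v) v = inner (chi A v) (chi A v).
  by rewrite -[in RHS]inner_chi chiI setIid.
rewrite inner_self -rmorphM; congr (_%:C); field.
by rewrite gt_eqF.
Qed.

Variables (S : set (H -> H)) (e0 : R).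
Hypotheses (e0_gt0 : 0 < e0) (equiS : equi_approximable S).
Hypothesis projS : forall a, S a -> projection a /\ rank_one a.
Hypothesis nonlocal : ~ exists2 s : R, 0 < s &
  forall a, S a -> exists xi : H,
    [/\ l2norm xi = 1, (diam (supp xi) <= s%:E)%E &
        (1 - e0) * opnorm a <= l2norm (a xi)].

(** By contradiction: if all these unit vectors had a coefficient of modulus at least [c],
    approximating [S] to within [e * c] would give one radius [s] such that each has norm at most
    [e] outside the [s]-neighbourhood of a point. The normalized truncations would then witness
    ONL. *)
Lemma delocalized_vector (c : R) : 0 < c ->
  exists v, [/\ S (rank1 v), l2norm v = 1 & forall x, normc (v x) < c].
Proof.
(* [e <= e0] gives the bound required by ONL, and [e <= 1/2] keeps the truncation of [v] nonzero. *)
move=> c0; pose e := Num.min e0 2^-1.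
have ee : e <= e0 by rewrite ge_min lexx.
have e2 : e <= 2^-1 by rewrite ge_min lexx orbT.
have ep : 0 < e by rewrite lt_min e0_gt0 invr_gt0 ltr0n.
have [_ approx] := equiS; have [s s0 sS] := approx _ (mulr_gt0 ep c0).
apply: contrapT => nov; apply: nonlocal; exists (s + s); first exact: addr_gt0.
move=> a Sa; have [pa ra] := projS Sa.
have [v v1 av] := rank_one_projectionP pa ra; subst a.
have [x cx] : exists x, c <= normc (v x).
  apply: contrapT => nx; apply: nov; exists v; split=> // x.
  by rewrite ltNge; apply/negP => cx; apply: nx; exists x.
have [b [bb bs vb]] := sS _ Sa.
have := localization_near_point v1 c0 (ltW ep) bb bs vb cx.
set A := [set y | _]; rewrite -chiC => vA.
have le := l2norm_ge_sub v (chi A v).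
have n0 : chi A v != 0.
  by apply/eqP => vA0; move: le vA; rewrite vA0 l2norm0 v1; lra.
exists (normalize (chi A v)); split.
- exact: l2norm_normalize.
- apply/diam_leP => y z; rewrite /supp/=.
  have suppA u : normalize (chi A v) u != 0 -> mdist x u <= s.
    rewrite /normalize ell2ZE chiE; case: ifPn => [/set_mem//|_].
    by rewrite mulr0 eqxx.
  move=> /suppA xy /suppA xz; apply: le_trans (metric_triangle _ x _) _.
  by rewrite metric_sym lerD.
- rewrite opnorm_rank1// mulr1 l2norm_rank1// inner_normalize_chi// normc_real.
  rewrite ger0_norm ?l2norm_ge0//; lra.
Qed.

(** A vector [v] with very small coefficients has little mass on [F]. Cutting it down to a finite
    set [B] outside [F] and normalizing moves it little. *)
Lemma finite_delocalized_vector F (d : R) : finite_set F -> 0 < d ->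
  exists w, [/\ [/\ l2norm w = 1, finite_set (supp w) & supp w `&` F = set0],
    (forall x, normc (w x) <= d) &
    exists v, [/\ S (rank1 v), l2norm v = 1 & l2norm (v - w) <= d]].
Proof.
move=> finF d0.
have /finite_setP[N FN] := finF.
(* Truncation and normalization each move [v] by at most [2 * e], in total [4 * e <= d]; the bound
   1/8 keeps the norm [t] of the truncation at least 3/4. *)
pose e := Num.min (d / 4) (8^-1).
have e8 : e <= 8^-1 by rewrite ge_min lexx orbT.
have ed : e <= d / 4 by rewrite ge_min lexx.
have e_gt0 : 0 < e by rewrite lt_min divr_gt0 ?invr_gt0 ?ltr0n.
have N0 : 0 < N.+1%:R :> R by rewrite ltr0n.
(* With coefficients below [e / N.+1], the [N] points of [F] carry squared norm at most [e ^+ 2]. *)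
have [v [Sv v1 vsmall]] := delocalized_vector (divr_gt0 e_gt0 N0).
have vF : l2norm (chi F v) <= e.
  rewrite -(@ler_pXn2r _ 2) ?nnegrE ?l2norm_ge0 ?(ltW e_gt0)//.
  have vs x : F x -> normc (v x) ^+ 2 <= (e / N.+1%:R) ^+ 2.
    move=> _; rewrite ler_pXn2r ?nnegrE ?normc_ge0 ?(ltW (vsmall x))//.
    by rewrite ltW// divr_gt0.
  have FN' : (F #<= `I_N)%card by rewrite (card_le_eql FN) card_lexx.
  apply: le_trans (l2norm_chi_le (sqr_ge0 _) FN' vs) _.
  rewrite expr_div_n mulrCA ger_pMr ?exprn_gt0//.
  rewrite ler_pdivrMr ?exprn_gt0// mul1r -natrX ler_nat.
  by rewrite (leq_trans (leqnSn N))// -mulnn leq_pmulr.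
have [G finG vG] := l2norm_tail v e_gt0.
pose B := G `\` F.
have vB : l2norm (v - chi B v) <= 2 * e.
  (* What is cut off is the part outside [G] and the part in both [G] and [F], each of norm at most
     [e]. *)
  rewrite (_ : v - chi B v = chi (~` G) v + chi G (chi F v)).
    apply: le_trans (l2normD _ _) _; have := l2norm_chi G (chi F v); lra.
  rewrite -chiC chiI; apply: ell2P => x.
  rewrite [RHS]ell2DE !ell2BE !chiE in_setD in_setI.
  by case: (x \in G) => /=; case: (x \in F); rewrite /= ?subr0 ?subrr ?add0r ?addr0.
set t := l2norm (chi B v).
have t1 : t <= 1 by rewrite -v1 l2norm_chi.
have t2 : 1 - t <= 2 * e by have := l2norm_ge_sub v (chi B v); rewrite v1 -/t; lra.
have n0 : chi B v != 0.
  apply/eqP => vB0; move: t2; rewrite /t vB0 l2norm0; lra.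
have tp : 0 < t by exact: l2norm_gt0.
have suppB x : normalize (chi B v) x != 0 -> B x.
  rewrite /normalize ell2ZE chiE; case: ifPn => [/set_mem//|_].
  by rewrite mulr0 eqxx.
exists (normalize (chi B v)); split.
- split; first exact: l2norm_normalize.
    apply: sub_finite_set finG => x /suppB[]//.
  by apply/seteqP; split=> // x [/suppB[]].
- move=> x; rewrite /normalize ell2ZE normcM normc_real ger0_norm ?invr_ge0 ?(ltW tp)//.
  rewrite -/t mulrC ler_pdivrMr//.
  have : normc (chi B v x) <= normc (v x).
    by rewrite chiE; case: ifP => // _; rewrite normc0 normc_ge0.
  have eN : e / N.+1%:R <= e by rewrite ler_pdivrMr// ler_peMr ?(ltW e_gt0)// ler1n.
  have dt : d / 4 <= d * t by rewrite ler_wpM2l ?(ltW d0)//; lra.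
  move=> /le_trans; apply; apply: le_trans (ltW (vsmall x)) _.
  exact: le_trans eN (le_trans ed dt).
- exists v; split => //.
  have -> : v - normalize (chi B v) = (v - chi B v) + (chi B v - normalize (chi B v)).
    by rewrite addrA subrK.
  apply: le_trans (l2normD _ _) _.
  (* Normalizing moves a vector of norm [t] along its own ray to norm 1. *)
  have -> : l2norm (chi B v - normalize (chi B v)) = 1 - t.
    have -> : chi B v - normalize (chi B v) = ((t - 1) / t)%:C *: chi B v.
      rewrite mulrBl divff ?gt_eqF// mul1r rmorphB rmorph1 scalerBl scale1r.
      by [].
    rewrite l2normZ normc_real normrM normfV (gtr0_norm tp) -/t mulfVK ?gt_eqF//.
    by rewrite distrC ger0_norm// subr_ge0.
  lra.
Qed.

End delocalized_vectors.

(** * The block projection of unit vectors with disjoint finite supports *)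

Section orthonormal_blocks.
Context {R : realType} {X : metricType R}.
Local Notation H := (ell2 R X).
Implicit Types (a b p : H -> H) (xi eta v : H) (A F : set X).

Lemma chi_supp xi : chi (supp xi) xi = xi.
Proof.
apply: ell2P => x; rewrite chiE; case: ifPn => //.
by rewrite notin_setE /supp/= => /negP/negPn/eqP.
Qed.

(** One occurrence of [v] is exchanged for [w] at a time, each at cost [l2norm (v - w)].
    Approximants of [rank1 v] thereby serve for [rank1 w]. *)
Lemma l2norm_rank1B v w xi : l2norm v = 1 -> l2norm w = 1 ->
  l2norm (rank1 v xi - rank1 w xi) <= 2 * l2norm (v - w) * l2norm xi.
Proof.
move=> v1 w1.
have -> : rank1 v xi - rank1 w xi = inner xi (v - w) *: v + inner xi w *: (v - w).
  by rewrite /rank1 innerBr scalerBl scalerBr addrA subrK.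
apply: le_trans (l2normD _ _) _; rewrite !l2normZ v1 mulr1.
have := Cauchy_Schwarz xi (v - w); have := Cauchy_Schwarz xi w; rewrite w1 mulr1.
move=> h1 h2; have := ler_wpM2r (l2norm_ge0 (v - w)) h1; lra.
Qed.

Variable w : nat -> H.
Hypothesis w1 : forall k, l2norm (w k) = 1.
Let Y k := supp (w k).
Hypothesis finY : forall k, finite_set (Y k).
Hypothesis disjY : trivIset setT Y.

Let p := block Y (fun k => rank1 (w k)).

Let rank1_bound k xi : l2norm (rank1 (w k) xi) <= 1 * l2norm xi.
Proof. by rewrite mul1r l2norm_rank1_le. Qed.

Let rank1_chi k xi : rank1 (w k) (chi (Y k) xi) = rank1 (w k) xi.
Proof. by rewrite /rank1 inner_chi chi_supp. Qed.

Let chi_rank1 k xi : chi (Y k) (rank1 (w k) xi) = rank1 (w k) xi.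
Proof.
by rewrite linear_opZ ?chi_supp//; exact: chi_linear.
Qed.

Let p_in xi k x : Y k x -> p xi x = rank1 (w k) xi x.
Proof. by move=> Yx; rewrite /p (block_in disjY ler01 rank1_bound _ Yx) rank1_chi. Qed.

Let p_out xi x : ~ (\bigcup_k Y k) x -> p xi x = 0.
Proof. exact: (block_out disjY ler01 rank1_bound). Qed.

Let chi_p k xi : chi (Y k) (p xi) = rank1 (w k) xi.
Proof.
by rewrite /p (chi_block disjY ler01 rank1_bound) compressE rank1_chi chi_rank1.
Qed.

Lemma compress_block_rank1 k : compress (Y k) p = rank1 (w k).
Proof. by apply/funext => xi; rewrite compressE chi_p rank1_chi. Qed.

(** The other vectors have supports disjoint from that of [w k], hence are orthogonal to it. This
    puts the whole sequence into the image of the unit ball, which will refute compactness. *)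
Lemma block_rank1_id k : p (w k) = w k.
Proof.
apply: ell2P => x; have [[j _ Yx]|nY] := pselect ((\bigcup_k Y k) x).
  rewrite (p_in _ Yx); have [->|jk] := eqVneq j k; first by rewrite rank1_id.
  have wkx : w k x = 0.
    apply/eqP/negPn/negP => Ykx; move/eqP: jk; apply.
    by apply: disjY => //; exists x.
  rewrite wkx /rank1 -[w k]chi_supp inner_chi.
  suff -> : chi (supp (w k)) (w j) = 0 by rewrite inner0r scale0r.
  rewrite -[w j]chi_supp chiI.
  have -> : supp (w k) `&` supp (w j) = set0; last exact: chi0.
  apply: contra_neq_eq jk => /set0P kj; apply/esym; exact: disjY.
rewrite p_out//; apply/esym/eqP/negPn/negP => wx; apply: nY.
by exists k.
Qed.

(** Writing the partial sums as truncations of [p xi] reduces their convergence to the smallness of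
    the tails of a single vector. *)
Lemma partial_sum_block n xi :
  \sum_(k < n) rank1 (w k) xi = chi (\bigcup_(k in `I_n) Y k) (p xi).
Proof.
elim: n => [|n IHn].
  by rewrite big_ord0 II0 bigcup_set0 chi0.
rewrite big_ord_recr/= IHn -chi_p; apply: ell2P => x.
rewrite ell2DE !chiE.
have [Yx|nYx] := boolP (x \in Y n).
  rewrite ifN; last first.
    rewrite notin_setE => -[k /= kn Ykx].
    have kE : k = n.
      apply: (disjY (i := k) (j := n)) => //; exists x; split=> //.
      exact/set_mem.
    by rewrite kE ltnn in kn.
  by rewrite add0r ifT//; apply/mem_set; exists n => /=; [|exact/set_mem].
rewrite addr0; congr (if _ then _ else _); apply/idP/idP => /set_mem[k /= kn Ykx].
  by apply/mem_set; exists k => //=; exact: ltnW.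
apply/mem_set; exists k => //=; move: kn; rewrite ltnS leq_eqVlt => /orP[/eqP kE|//].
by move: nYx; rewrite notin_setE -kE.
Qed.

(** A finite [F] carries [p xi] up to [e], and only finitely many supports meet [F]. Once these are
    included, the error vanishes on [F] and is dominated by the tail. *)
Lemma partial_sum_block_cvg xi :
  (fun n => \sum_(k < n) rank1 (w k) xi) @ \oo --> p xi.
Proof.
apply/cvg_l2normP => e e0; have [F finF Fe] := l2norm_tail (p xi) e0.
have [K KF] := trivIset_avoid_finite disjY finF.
exists K => n Kn; apply: le_trans Fe.
rewrite partial_sum_block chiC; apply: l2norm_mono => x.
rewrite !chiE !in_setC; case: ifPn => nZ; last by rewrite normc0 normc_ge0.
have [xF|//] := boolP (x \in F); rewrite p_out// => -[k _ Ykx].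
have [Kk|kK] := leqP K k.
  have YF : (Y k `&` F) x by split=> //; exact/set_mem.
  by rewrite KF in YF.
move/negP: nZ; apply; apply/mem_set; exists k => //=.
exact: leq_trans kK Kn.
Qed.

Lemma block_rank1_idem xi : p (p xi) = p xi.
Proof.
apply: ell2P => x; have [[j _ Yx]|nY] := pselect ((\bigcup_k Y k) x).
  apply: etrans (p_in (p xi) Yx) (etrans _ (esym (p_in xi Yx))).
  by rewrite -(rank1_chi j (p xi)) chi_p rank1_idem.
exact: etrans (p_out (p xi) nY) (esym (p_out xi nY)).
Qed.

Lemma inner_partial_sum n xi eta :
  inner (\sum_(k < n) rank1 (w k) xi) eta = inner xi (\sum_(k < n) rank1 (w k) eta).
Proof.
elim: n => [|n IHn]; first by rewrite !big_ord0 inner0l inner0r.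
by rewrite !big_ord_recr/= innerDl innerDr IHn inner_rank1.
Qed.

(** Each partial sum is self-adjoint, and the identity passes to the limit, both series being cut at
    the common index [maxn N K]. *)
Lemma block_rank1_selfadjoint xi eta : inner (p xi) eta = inner xi (p eta).
Proof.
apply/subr0_eq/eq0_normc/eqP; rewrite eq_le normc_ge0 andbT.
apply/ler_addgt0Pl => e e0; rewrite addr0.
have [x0 y0] := (l2norm_ge0 xi, l2norm_ge0 eta).
(* The summand 1 keeps the denominator positive when both vectors vanish. *)
have D0 : 0 < l2norm xi + l2norm eta + 1 by lra.
have /cvg_l2normP/(_ _ (divr_gt0 e0 D0))[N hN] := partial_sum_block_cvg (xi := xi).
have /cvg_l2normP/(_ _ (divr_gt0 e0 D0))[K hK] := partial_sum_block_cvg (xi := eta).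
have {}hN := hN _ (leq_maxl N K); have {}hK := hK _ (leq_maxr N K).
set T := fun z => \sum_(k < maxn N K) rank1 (w k) z.
have -> : inner (p xi) eta - inner xi (p eta) =
    inner (p xi - T xi) eta - inner xi (p eta - T eta).
  have TT : inner (T xi) eta = inner xi (T eta) by exact: inner_partial_sum.
  by rewrite innerBl innerBr TT opprB addrA subrK.
apply: le_trans (le_normcD _ _) _; rewrite normcN.
apply: le_trans (lerD (Cauchy_Schwarz _ _) (Cauchy_Schwarz _ _)) _.
set r := e / _ in hN hK.
have re : r * (l2norm xi + l2norm eta + 1) = e by rewrite /r divfK// gt_eqF.
have r0 : 0 < r by exact: divr_gt0.
have := ler_wpM2r y0 hN; have := ler_wpM2l x0 hK; rewrite -/(T xi) -/(T eta).
move: re; rewrite !mulrDr mulr1 (mulrC r (l2norm xi)); lra.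
Qed.

Lemma bounded_block_rank1 : bounded_operator p.
Proof. by apply: (bounded_block disjY ler01 rank1_bound) => k; exact: linear_rank1. Qed.

Lemma projection_block_rank1 : projection p.
Proof.
split; first exact: bounded_block_rank1.
  exact: block_rank1_idem.
exact: block_rank1_selfadjoint.
Qed.

(** A cluster point of the sequence [w] of fixed vectors would have two of them within distance 1/2,
    hence less than 1 apart; disjoint supports keep them at least 1 apart. *)
Lemma not_compact_block_rank1 : ~ compact_operator p.
Proof.
move=> /(_ (w @ \oo) _)[|v [_ clv]].
  exists 0%N => // n _; apply: subset_closure; exists (w n); rewrite /= ?w1//.
  exact: block_rank1_id.
have near_v : nbhs v (ball v (2^-1)%:C).
  by apply: nbhsx_ballx; rewrite ltcR invr_gt0.
have [_ [[k _ <-] wk]] := clv (range w) _ (filterE _ (fun n => imageT w n)) near_v.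
(* Clustering along the tail beyond [k] supplies a second index distinct from [k]. *)
have [] := clv [set w m | m in [set m | (k < m)%N]] _ _ near_v.
  by exists k.+1 => // m km; exists m.
move=> _ [[m km <-] wm]; move: wk wm.
rewrite -!ball_normE/= !ell2_normE !ltcR => wk wm.
have : 1 <= l2norm (w k - w m).
  (* Truncation to [Y k] keeps [w k] and kills [w m]. *)
  have kE : w k = chi (Y k) (w k - w m).
    apply: ell2P => x; rewrite chiE; case: ifPn => [/set_mem Yx|].
      rewrite ell2BE; suff -> : w m x = 0 by rewrite subr0.
      apply/eqP/negPn/negP => Ymx; have kmE : k = m by apply: disjY => //; exists x.
      by move: km; rewrite /= kmE ltnn.
    by rewrite notin_setE /Y /supp/= => /negP/negPn/eqP.
  by apply: le_trans (l2norm_chi (Y k) _); rewrite -kE w1.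
have -> : w k - w m = (v - w m) - (v - w k) by rewrite opprB [RHS]addrC subrKA.
have := l2normB_le (v - w m) (v - w k); lra.
Qed.

(** The approximants, compressed to the supports and assembled by [block], have propagation at most
    [s], and the error is again block diagonal with blocks of norm at most [e]. *)
Lemma Roe_block_rank1 :
  (forall e : R, 0 < e -> exists s : R, forall k, exists b,
     [/\ bounded_operator b, (prop b <= s%:E)%E &
         forall xi, l2norm (rank1 (w k) xi - b xi) <= e * l2norm xi]) ->
  Roe p.
Proof.
move=> approx; split; first exact: bounded_block_rank1.
move=> e e0; have [s /choice[b bP]] := approx e e0.
(* A uniform bound on the approximants ensures that [block Y b] is the intended operator and not the
   default 0. *)
have bM k xi : l2norm (b k xi) <= (1 + e) * l2norm xi.
  have [_ _ /(_ xi)] := bP k; rewrite l2normB.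
  have := l2norm_ge_sub (b k xi) (rank1 (w k) xi); have := rank1_bound k xi; lra.
have M0 : 0 <= 1 + e by lra.
have lb k : linear (b k) by have [[]] := bP k.
have bb := bounded_block disjY M0 bM lb.
exists (block Y b); split=> //.
  apply: (@le_lt_trans _ _ s%:E); last exact: ltry.
  apply/prop_leP => x y; rewrite (blockE disjY M0 bM) /block_fun compressE.
  set k := xget _ _; rewrite chiE chi_delta; case: ifP => _; last by rewrite eqxx.
  case: ifP => _; last by rewrite linear_op0// eqxx.
  by have [_ /prop_leP + _] := bP k; apply.
apply: opnorm_le (ltW e0) _ => xi.
have dM k eta : l2norm ((rank1 (w k) \- b k) eta) <= e * l2norm eta.
  by have [_ _ h] := bP k; exact: h.
apply: le_trans (l2norm_block disjY (ltW e0) dM xi).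
rewrite le_eqVlt; apply/orP; left; apply/eqP; congr l2norm; apply: ell2P => x.
rewrite (blockE disjY (ltW e0) dM) ell2BE (blockE disjY M0 bM).
rewrite /p (blockE disjY ler01 rank1_bound) /block_fun !compressE.
by rewrite !chiE; case: ifP => _; rewrite ?subrr.
Qed.

(** For [x] in [Y k], the entry at [(x, z)] is the product of [w k x] and the conjugate of [w k z];
    off the first [K] supports only indices [k >= K] occur. *)
Lemma ghost_block_rank1 : Roe p ->
  (forall e : R, 0 < e -> exists K : nat, forall k, (K <= k)%N ->
     forall x, normc (w k x) <= e) -> ghost p.
Proof.
move=> Rp wsmall; split=> // e e0.
(* An entry is a product of two coefficients: one is bounded by 1, the other by [e]. *)
have e1 : 0 < Num.min e 1 by rewrite lt_min e0 ltr01.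
have [K hK] := wsmall _ e1.
exists (\bigcup_(k in `I_K) Y k).
  by apply: bigcup_finite => // k _; exact: finY.
move=> x z nx nz; rewrite entryE.
have [[k _ Yx]|nY] := pselect ((\bigcup_k Y k) x); last by rewrite p_out// normc0 ltW.
have Kk : (K <= k)%N by rewrite leqNgt; apply/negP => kK; apply: nx; exists k.
rewrite (p_in _ Yx) rank1_delta ell2ZE normcM normc_conj.
have := hK k Kk x; have := hK k Kk z.
rewrite !le_min => /andP[h1 h2] /andP[h3 h4].
by rewrite -[e]mul1r ler_pM ?normc_ge0.
Qed.

Lemma block_rank_one_projection_block_rank1 : Roe p -> block_rank_one_projection p.
Proof.
move=> Rp; split; [exact: Rp|exact: projection_block_rank1|].
exists Y; split; first exact: disjY.
- move=> n; split; [exact: finY|apply/set0P/eqP => Y0].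
  have := w1 n; rewrite -[w n]chi_supp -/(Y n) Y0 chi0 l2norm0 => /eqP.
  by rewrite eq_sym oner_eq0.
- move=> xi; rewrite (_ : (fun n => _) = fun n => \sum_(k < n) rank1 (w k) xi).
    exact: partial_sum_block_cvg.
  by apply/funext => n; apply: eq_bigr => k _; rewrite chi_p rank1_chi.
- move=> n; rewrite -[_ \o _]/(compress (Y n) p) compress_block_rank1.
  exact: rank_one_rank1.
Qed.

End orthonormal_blocks.

(** * Construction of the ghost from a failure of ONL *)

Section construction.
Context {R : realType} {X : metricType R}.
Local Notation H := (ell2 R X).

Lemma exists_harmonic_lt (e : R) : 0 < e ->
  exists K : nat, forall k, (K <= k)%N -> (k.+1%:R)^-1 <= e.
Proof.
move=> e0; exists (Num.bound e^-1) => k Kk.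
rewrite -[e]invrK lef_pV2 ?posrE ?invr_gt0 ?ltr0n//.
have einv0 : 0 <= e^-1 by rewrite invr_ge0 ltW.
apply: le_trans (ltW (archi_boundP einv0)) _.
by rewrite ler_nat (leq_trans Kk).
Qed.

Lemma nonlocal_ghost (e0 : R) (S : set (H -> H)) : 0 < e0 ->
  equi_approximable S -> (forall a, S a -> projection a /\ rank_one a) ->
  ~ (exists2 s : R, 0 < s &
    forall a, S a -> exists xi : H,
      [/\ l2norm xi = 1, (diam (supp xi) <= s%:E)%E &
          (1 - e0) * opnorm a <= l2norm (a xi)]) ->
  exists p : H -> H, [/\ block_rank_one_projection p, ghost p & ~ compact_operator p].
Proof.
move=> e0_gt0 equiS projS nonlocal.
pose d n : R := n.+1%:R^-1.
have d0 n : 0 < d n by rewrite invr_gt0 ltr0n.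
(* The finiteness hypothesis sits inside [good] so that a choice function exists on all pairs; for
   an infinite set the vector 0 will do. *)
pose good (Fn : set X * nat) (w : H) := finite_set Fn.1 ->
  [/\ [/\ l2norm w = 1, finite_set (supp w) & supp w `&` Fn.1 = set0],
    (forall x, normc (w x) <= d Fn.2) &
    exists v, [/\ S (rank1 v), l2norm v = 1 & l2norm (v - w) <= d Fn.2]].
have /choice[g gP] : forall Fn, exists w, good Fn w.
  move=> [F n]; have [finF|nfinF] := pselect (finite_set F); last by exists 0.
  have [w wP] := finite_delocalized_vector e0_gt0 equiS projS nonlocal finF (d0 n).
  by exists w.
(* [used n] collects the supports of the first [n] vectors, which the next one has to avoid. *)
pose used := fix used n : set X :=
  if n is m.+1 then used m `|` supp (g (used m, m)) else set0.
pose w n := g (used n, n).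
have fin_used n : finite_set (used n).
  elim: n => [|n IHn]; first exact: finite_set0.
  by rewrite /= finite_setU; split=> //; have [[]] := gP (used n, n) IHn.
have wP n := gP (used n, n) (fin_used n).
have used_mono : {homo used : m n / (m <= n)%N >-> m `<=` n}.
  move=> m n; elim: n => [|n IHn]; first by rewrite leqn0 => /eqP ->.
  rewrite leq_eqVlt => /orP[/eqP ->//|]; rewrite ltnS => /IHn mn.
  by apply: subset_trans mn _; exact: subsetUl.
have disj_lt i j : (i < j)%N -> supp (w i) `&` supp (w j) = set0.
  move=> ij; apply/seteqP; split=> // x [wi wj].
  have [[_ _ <-] _ _] := wP j; split=> //.
  by apply: (used_mono i.+1 j ij); right.
have w1 n : l2norm (w n) = 1 by have [[]] := wP n.
have finY n : finite_set (supp (w n)) by have [[]] := wP n.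
have disjY : trivIset setT (fun n => supp (w n)).
  move=> i j _ _ [x [wi wj]]; apply/eqP; case: ltngtP => // ij; exfalso.
  - by have : (supp (w i) `&` supp (w j)) x by []; rewrite disj_lt.
  - by have : (supp (w j) `&` supp (w i)) x by []; rewrite disj_lt.
have wsmall (e : R) : 0 < e -> exists K : nat, forall k, (K <= k)%N ->
    forall x, normc (w k x) <= e.
  move=> /exists_harmonic_lt[K hK]; exists K => k Kk x.
  by apply: le_trans (hK _ Kk); have [_ + _] := wP k; apply.
(* The finitely many [w k] with [k < K] may be far from the family; their finite supports bound the
   propagation directly. *)
have finite_prop K : exists2 s : R, 0 < s &
    forall k, (k < K)%N -> (prop (rank1 (w k)) <= s%:E)%E.
  elim: K => [|K [s s0 hs]]; first by exists 1.
  have [t t0 ht] := finite_mdist_bounded (finY K).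
  exists (s + t) => [|k]; first exact: addr_gt0.
  rewrite ltnS leq_eqVlt => /orP[/eqP ->|/hs].
    apply/prop_leP => x y; rewrite rank1_delta ell2ZE mulf_eq0 conjC_eq0 negb_or.
    by move=> /andP[wx wy]; apply: le_trans (ht _ _ wx wy) _; rewrite lerDr ltW.
  by move=> /le_trans; apply; rewrite lee_fin lerDl ltW.
have approx (e : R) : 0 < e -> exists s : R, forall k, exists b,
     [/\ bounded_operator b, (prop b <= s%:E)%E &
         forall xi, l2norm (rank1 (w k) xi - b xi) <= e * l2norm xi].
  (* For [k >= K], [w k] is within [e / 4] of some [v] with [rank1 v] in [S], so the two operators
     differ by at most [e / 2]; approximating [rank1 v] takes the other [e / 2]. Below [K],
     [rank1 (w k)] is its own approximant. *)
  move=> e_gt0; have e4 : 0 < e / 4 by rewrite divr_gt0.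
  have [K hK] := exists_harmonic_lt e4.
  have [s s0 hs] := finite_prop K.
  have e2 : 0 < e / 2 by rewrite divr_gt0.
  have [_ /(_ _ e2)[t t0 ht]] := equiS.
  exists (s + t) => k; have [kK|Kk] := ltnP k K.
    exists (rank1 (w k)); split; first exact: bounded_rank1.
      by apply: le_trans (hs _ kK) _; rewrite lee_fin lerDl ltW.
    by move=> xi; rewrite subrr l2norm0 mulr_ge0 ?l2norm_ge0 ?ltW.
  have [_ _ [v [Sv v1 vw]]] := wP k.
  have [b [bb bt vb]] := ht _ Sv; exists b; split=> //.
    by apply: le_trans bt _; rewrite lee_fin lerDr ltW.
  move=> xi; have := opnormB_le xi (bounded_rank1 v1) bb vb.
  have := l2norm_rank1B xi (w1 k) v1; rewrite (l2normB (w k)).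
  have := l2normD (rank1 (w k) xi - rank1 v xi) (rank1 v xi - b xi).
  rewrite subrKA => h1 h2 h3.
  have h4 := ler_wpM2r (l2norm_ge0 xi) (le_trans vw (hK _ Kk)).
  lra.
have Rp := Roe_block_rank1 w1 disjY approx.
exists (block (fun n => supp (w n)) (fun k => rank1 (w k))); split.
- exact: block_rank_one_projection_block_rank1.
- exact: ghost_block_rank1.
- exact: not_compact_block_rank1.
Qed.

End construction.

Theorem theorem1p4 (R : realType) (X : metricType R)
    (hX : uniformly_locally_finite X) :
  (~ exists p : ell2 R X -> ell2 R X,
      [/\ block_rank_one_projection p, ghost p & ~ compact_operator p]) <->
  ONL_rank_one_projections X.
Proof.
split=> [noghost e S e0 equiS projS|onl [p [[Rp pp [Y [disjY _ pY rk]]] gh _]]].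
  by apply: contrapT => /(nonlocal_ghost e0 equiS projS)/noghost.
exact: (block_rank_one_not_ghost Rp pp disjY pY hX rk onl).
Qed.
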